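(* Let $\Bbbk$ be an algebraically closed field of arbitrary characteristic. There exist irreducible curves $C, D \subset \mathbb{P}^2$ of degree $8$, both with multiplicity sequence $(3_{(7)})$, that are not projectively equivalent but such that $\mathbb{P}^2\setminus C$ and $\mathbb{P}^2\setminus D$ are isomorphic.
   Context: Two curves are projectively equivalent if some automorphism of $\mathbb{P}^2$ maps one onto the other. A curve $C$ has multiplicity sequence $(3_{(7)})$ if $C$ has (proper or infinitely near) singular points $p_1,\dots,p_7$, each of multiplicity $3$, with $p_1\in C$ a proper point of $\mathbb{P}^2$, $p_{i+1}$ lying in the first neighborhood of $p_i$ (i.e. on the exceptional curve of the blow-up of $p_i$) for $i\ge1$, and $C$ smooth at all other (proper or infinitely near) points. *)

(* Defs.v *)
From HB Require Import structures.
From mathcomp Require Import all_boot all_order all_algebra.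
From mathcomp Require Export mpoly.
Set Implicit Arguments. Unset Strict Implicit. Unset Printing Implicit Defensive.
Import Order.TTheory GRing.Theory Num.Theory.
Local Open Scope ring_scope.

Section PlaneCurves.
Variable k : closedFieldType.

(* Points of P^2 are represented by nonzero column vectors of k^3. *)
Definition ev (F : {mpoly k[3]}) (v : 'cV[k]_3) : k := F.@[fun i => v i 0].
Definition evH (H : 'I_3 -> {mpoly k[3]}) (v : 'cV[k]_3) : 'cV[k]_3 :=
  \col_i ev (H i) v.
Definition proj_eq (u v : 'cV[k]_3) : Prop := exists2 c : k, c != 0 & u = c *: v.

Definition mirreducible (F : {mpoly k[3]}) : Prop :=
  F \isn't a GRing.unit /\
  forall G H : {mpoly k[3]}, F = G * H -> G \is a GRing.unit \/ H \is a GRing.unit.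

Definition irreducible_plane_curve (d : nat) (F : {mpoly k[3]}) : Prop :=
  F \is d.-homog /\ F != 0 /\ mirreducible F.

Definition proj_equiv (F G : {mpoly k[3]}) : Prop :=
  exists A : 'M[k]_3, A \in unitmx /\
    forall p : 'cV[k]_3, p != 0 -> (ev F p == 0) = (ev G (A *m p) == 0).

Definition mult0 (g : {mpoly k[2]}) (m : nat) : Prop :=
  g != 0 /\ (forall mo, mo \in msupp g -> (m <= mdeg mo)%N) /\
  exists2 mo, mo \in msupp g & mdeg mo = m.

(* Affine chart of P^2 given by A in GL_3: (x,y) |-> A (x,y,1);
   the origin goes to the point A (0,0,1) = col 2 A. *)
Definition chart_subst (A : 'M[k]_3) : 3.-tuple {mpoly k[2]} :=
  [tuple A i 0 *: 'X_0 + A i 1 *: 'X_1 + (A i ord_max)%:MP | i < 3].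
Definition affine_chart (F : {mpoly k[3]}) (A : 'M[k]_3) : {mpoly k[2]} :=
  F \mPo chart_subst A.

Definition lin2 (L : 'M[k]_2) : 2.-tuple {mpoly k[2]} :=
  [tuple L i 0 *: 'X_0 + L i 1 *: 'X_1 | i < 2].

(* Blow-up of the origin, chart (x, y') with y = x y'; the exceptional
   curve is x = 0 and the origin of this chart is the point of the first
   neighbourhood corresponding to the tangent direction y = 0. *)
Definition blowup_subst : 2.-tuple {mpoly k[2]} := [tuple 'X_0; 'X_0 * 'X_1].

Definition strict_transform (g : {mpoly k[2]}) (m : nat) (s : {mpoly k[2]}) : Prop :=
  g \mPo blowup_subst = 'X_0 ^+ m * s.

(* C = V(F) has multiplicity sequence (3_(7)):
   p1 = col 2 A is a proper triple point; g 0 is the local equation at p1;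
   for i < 6, Ls i chooses the point p_(i+2) in the first neighbourhood of
   p_(i+1) (the direction (Ls i) e_1), and g (i+1) is the local equation of the
   strict transform at p_(i+2), which is a triple point; all points of the
   first neighbourhood of p7 and all proper points other than p1 have
   multiplicity <= 1. *)
Definition mult_seq_3_7 (F : {mpoly k[3]}) : Prop :=
  exists (A : 'M[k]_3) (Ls : nat -> 'M[k]_2) (g : nat -> {mpoly k[2]}),
    A \in unitmx /\
    (forall i, (i < 6)%N -> Ls i \in unitmx) /\
    g 0%N = affine_chart F A /\
    (forall i, (i < 7)%N -> mult0 (g i) 3) /\
    (forall i, (i < 6)%N ->
           strict_transform (g i \mPo lin2 (Ls i)) 3 (g i.+1)) /\
    (forall L : 'M[k]_2, L \in unitmx -> forall s m,
           strict_transform (g 6%N \mPo lin2 L) 3 s -> mult0 s m -> (m <= 1)%N) /\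
    (forall q : 'cV[k]_3, q != 0 -> ev F q = 0 -> ~ proj_eq q (col ord_max A) ->
           forall B : 'M[k]_3, B \in unitmx -> col ord_max B = q ->
           forall m, mult0 (affine_chart F B) m -> (m <= 1)%N).

Definition in_compl (F : {mpoly k[3]}) (p : 'cV[k]_3) : Prop := p != 0 /\ ev F p != 0.

Definition regular_map (F G : {mpoly k[3]}) (f : 'cV[k]_3 -> 'cV[k]_3) : Prop :=
  [/\ (forall p, in_compl F p -> in_compl G (f p)),
      (forall p q, in_compl F p -> proj_eq q p -> proj_eq (f q) (f p))
    & (forall p, in_compl F p ->
        exists (d : nat) (H : 'I_3 -> {mpoly k[3]}),
          [/\ (forall i, H i \is d.-homog), evH H p != 0 &
              forall q, in_compl F q -> evH H q != 0 -> proj_eq (f q) (evH H q)])].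

Definition compl_isomorphic (F G : {mpoly k[3]}) : Prop :=
  exists (f g : 'cV[k]_3 -> 'cV[k]_3),
    [/\ regular_map F G f, regular_map G F g,
        (forall p, in_compl F p -> proj_eq (g (f p)) p)
      & (forall q, in_compl G q -> proj_eq (f (g q)) q)].

End PlaneCurves.

(* Main.v *)
Require Import Defs.
From HB Require Import structures.
From mathcomp Require Import all_boot all_order all_algebra.
From mathcomp Require Import mpoly.
From mathcomp Require Import ring.
Set Implicit Arguments. Unset Strict Implicit. Unset Printing Implicit Defensive.
Import Order.TTheory GRing.Theory Num.Theory.
Local Open Scope ring_scope.

(**
Let N be the nodal cubic xyz = x^3 + e y^3. There is a birational involution phi
of degree 8 of the plane, regular on the complement of N, which blows up the node
of N and six further points infinitely near to it along one of its two branches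
and contracts N. Let l = 0 be a line tangent to N at a smooth point r, meeting N
again at s, and let the octic C_e be its preimage by phi. Hence C_e is rational
and smooth away from the node, where it has seven infinitely near triple points.

The affine plane l <> 0 has a quadratic involution alpha which preserves N and
exchanges the branches at the node. So alpha lifts to an isomorphism between the
complement of C_e and the complement of the octic built from the same line with
the other branch, and interchanging x and y identifies the latter with C_(1/e).

A projective equivalence from C_e to C_(1/e) induces a map of the parameter line
preserving {r, s}, hence a scaling of the parameter; comparing the coordinate of
lowest degree of the two parametrizations gives e (e - 3)^2 = e' (e' - 3)^2
with e' = 1/e, that is (e - 1)^3 (e + 1) (e^2 - 4 e + 1) = 0.
*)

(** * The nodal cubic and its involution *)

(** The formulas live over an arbitrary commutative ring because each is needed three times: at
    points of k^3, at the generic point over [{mpoly k[3]}], where [cub] can be cancelled, and along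
    arcs over [{poly k}]. The [_scal] and [_map] lemmas carry degrees and identities between these
    settings, so the forms of degree 128 and 180 are never expanded.

    The obstacle is that N minus its node lies in the complement of C_e, while phi contracts N: the
    composite phi, alpha, swap, phi is given by forms that all vanish on N, and a power of [cub] has
    to be divided out before it is seen to be regular there.

    Excluded parameters: e = 1 makes r a flex, so that r = s; e = -1 and the roots of e^2 - 4 e + 1
    satisfy the final equation; e = -2 puts (0 : 1 : 0) on the tangent line used for 1/e, which
    would spoil a coprimality argument. *)

Section Cremona.
Variable R : comNzRingType.
Implicit Types (e x y z c : R) (v : R * R * R).

(* With [x0 = x], [x1 = y] and [cub = 1], the relations [x2_rel], [x3_rel] are
   the rank 2 cluster exchanges [x0 x2 = 1 + e x1^3], [x1 x3 = 1 + x2^3], and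
   [z1_], [z2_] are the third coordinates attached to [(x1, x2)], [(x2, x3)];
   [phi] shifts the exchange sequence by two and reverses it, which is why it
   is an involution of the plane, regular off the nodal cubic [cub = 0]. *)
Definition cub e v := let: (x, y, z) := v in x * y * z - x ^+ 3 - e * y ^+ 3.
Definition x2_ v := let: (x, y, z) := v in y * z - x ^+ 2.
Definition z1_ e v :=
  let: (x, y, z) := v in y * z ^+ 2 - x ^+ 2 * z - e * x * y ^+ 2.
Definition x3_ e v :=
  let: (x, y, z) := v in x2_ v * z1_ e v - e * cub e v * y ^+ 2.
Definition z2_ e v := let: (x, y, z) := v in
  x2_ v * z1_ e v ^+ 2 - 2 * e * z1_ e v * cub e v * y ^+ 2
  + e * cub e v ^+ 2 * x * y.
Definition phi e v : R * R * R :=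
  (x3_ e v * cub e v, x2_ v * cub e v ^+ 2, z2_ e v).
(* [cub e v = x y l - (x + y)^2 (x + e y)] with [l = lin e v]: the line [l = 0]
   is tangent to the nodal cubic where [x + y = 0]. *)
Definition lin e v := let: (x, y, z) := v in z + (1 + 2 * e) * y + (2 + e) * x.
Definition oct e v := lin e (phi e v).
Definition scal c v : R * R * R := let: (x, y, z) := v in (c * x, c * y, c * z).

Lemma scalA c d v : scal c (scal d v) = scal (c * d) v.
Proof. by case: v => [[x y] z]; rewrite /scal !mulrA. Qed.
Lemma cub_scal e c v : cub e (scal c v) = c ^+ 3 * cub e v.
Proof. by case: v => [[x y] z]; rewrite /cub /scal; ring. Qed.
Lemma x2_scal c v : x2_ (scal c v) = c ^+ 2 * x2_ v.
Proof. by case: v => [[x y] z]; rewrite /x2_ /scal; ring. Qed.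
Lemma z1_scal e c v : z1_ e (scal c v) = c ^+ 3 * z1_ e v.
Proof. by case: v => [[x y] z]; rewrite /z1_ /scal; ring. Qed.
Lemma x3_scal e c v : x3_ e (scal c v) = c ^+ 5 * x3_ e v.
Proof.
rewrite /x3_; case: v => [[x y] z]; have /= := cub_scal e c (x, y, z).
have /= -> := x2_scal c (x, y, z); have /= -> := z1_scal e c (x, y, z) => ->.
ring.
Qed.
Lemma z2_scal e c v : z2_ e (scal c v) = c ^+ 8 * z2_ e v.
Proof.
rewrite /z2_; case: v => [[x y] z]; have /= := cub_scal e c (x, y, z).
have /= -> := x2_scal c (x, y, z); have /= -> := z1_scal e c (x, y, z) => ->.
ring.
Qed.
Lemma phi_scal e c v : phi e (scal c v) = scal (c ^+ 8) (phi e v).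
Proof.
rewrite /phi cub_scal x2_scal x3_scal z2_scal /scal.
by congr (_, _, _); ring.
Qed.
Lemma lin_scal e c v : lin e (scal c v) = c * lin e v.
Proof. by case: v => [[x y] z]; rewrite /lin /scal; ring. Qed.
Lemma oct_scal e c v : oct e (scal c v) = c ^+ 8 * oct e v.
Proof. by rewrite /oct phi_scal lin_scal. Qed.

Section Relations.
Variables e x y z : R.
Let v := (x, y, z).
Let f := cub e v.
Let p := x2_ v.
Let w := z1_ e v.
Let q := x3_ e v.
Let r := z2_ e v.

Lemma x2_rel : x * p = f + e * y ^+ 3.
Proof. by rewrite /f /p /=; ring. Qed.
Lemma z1_rel : y * w = x * f + p ^+ 2.
Proof. by rewrite /f /p /w /=; ring. Qed.
Lemma x3E : q = p * w - e * f * y ^+ 2. Proof. by []. Qed.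
Lemma z2E : r = p * w ^+ 2 - 2 * e * w * f * y ^+ 2 + e * f ^+ 2 * x * y.
Proof. by []. Qed.
Lemma x3_rel : y * q = f ^+ 2 + p ^+ 3.
Proof.
have -> : y * q = p * (y * w) - e * y ^+ 3 * f by rewrite x3E; ring.
have -> : e * y ^+ 3 = x * p - f by rewrite x2_rel; ring.
by rewrite z1_rel; ring.
Qed.
Lemma z2_rel : p * r = e * y * f ^+ 3 + q ^+ 2.
Proof.
have -> : p * r = (p * w) ^+ 2 - 2 * e * (p * w) * f * y ^+ 2
    + e * f ^+ 2 * y * (x * p) by rewrite z2E; ring.
by rewrite x2_rel x3E; ring.
Qed.
(** This relation and [z1_rel_z] run the exchanges backwards: up to f^2 they recover w, then z, from
    the later coordinates. They are what makes [z1_phi] and [z2_phi] collapse. *)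
Lemma z2_rel_z1 : y * r - q * p ^+ 2 = f ^+ 2 * w.
Proof.
have -> : y * r = p * w * (y * w) - 2 * e * (y * w) * f * y ^+ 2
    + e * f ^+ 2 * x * y ^+ 2 by rewrite z2E; ring.
rewrite z1_rel x3E.
have -> : p * w * (x * f + p ^+ 2) - 2 * e * (x * f + p ^+ 2) * f * y ^+ 2
  + e * f ^+ 2 * x * y ^+ 2 - (p * w - e * f * y ^+ 2) * p ^+ 2
  = f * ((x * p) * w - e * y ^+ 2 * (x * f + p ^+ 2)) by ring.
by rewrite x2_rel -z1_rel; ring.
Qed.
Lemma z1_rel_z : y * w ^+ 2 - 2 * w * p ^+ 2 + q * p = z * f ^+ 2.
Proof. by rewrite x3E /f /p /w /=; ring. Qed.

(** The preimage of the cubic is the cubic alone, so phi maps its complement to itself. *)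
Lemma cub_phi : cub e (phi e v) = e * f ^+ 8.
Proof.
have -> : cub e (phi e v) = q * f * (p * f ^+ 2) * r - (q * f) ^+ 3
  - e * (p * f ^+ 2) ^+ 3 by [].
have -> : q * f * (p * f ^+ 2) * r = q * f ^+ 3 * (p * r) by ring.
rewrite z2_rel.
have -> : q * f ^+ 3 * (e * y * f ^+ 3 + q ^+ 2)
  = e * f ^+ 6 * (y * q) + (q * f) ^+ 3 by ring.
by rewrite x3_rel; ring.
Qed.

Lemma x2_phi : x2_ (phi e v) = e * y * f ^+ 5.
Proof.
have -> : x2_ (phi e v) = p * f ^+ 2 * r - (q * f) ^+ 2 by [].
have -> : p * f ^+ 2 * r = f ^+ 2 * (p * r) by ring.
by rewrite z2_rel; ring.
Qed.

Lemma z1_phi : z1_ e (phi e v) = e * f ^+ 7 * w.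
Proof.
have -> : z1_ e (phi e v) = p * f ^+ 2 * r ^+ 2 - (q * f) ^+ 2 * r
  - e * (q * f) * (p * f ^+ 2) ^+ 2 by [].
have -> : p * f ^+ 2 * r ^+ 2 - (q * f) ^+ 2 * r - e * (q * f) * (p * f ^+ 2) ^+ 2
  = f ^+ 2 * r * (p * r) - q ^+ 2 * f ^+ 2 * r - e * q * p ^+ 2 * f ^+ 5 by ring.
rewrite z2_rel.
have -> : e * f ^+ 7 * w = e * f ^+ 5 * (f ^+ 2 * w) by ring.
by rewrite -z2_rel_z1; ring.
Qed.

Lemma x3_phi : x3_ e (phi e v) = e ^+ 2 * x * f ^+ 13.
Proof.
have -> : x3_ e (phi e v) = x2_ (phi e v) * z1_ e (phi e v)
   - e * cub e (phi e v) * (p * f ^+ 2) ^+ 2 by [].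
rewrite cub_phi x2_phi z1_phi.
have -> : e ^+ 2 * x * f ^+ 13 = e ^+ 2 * f ^+ 12 * (x * f) by ring.
have -> : x * f = y * w - p ^+ 2 by rewrite z1_rel; ring.
by ring.
Qed.

Lemma z2_phi : z2_ e (phi e v) = e ^+ 3 * z * f ^+ 21.
Proof.
have -> : z2_ e (phi e v) = x2_ (phi e v) * z1_ e (phi e v) ^+ 2
   - 2 * e * z1_ e (phi e v) * cub e (phi e v) * (p * f ^+ 2) ^+ 2
   + e * cub e (phi e v) ^+ 2 * (q * f) * (p * f ^+ 2) by [].
rewrite cub_phi x2_phi z1_phi.
have -> : e ^+ 3 * z * f ^+ 21 = e ^+ 3 * f ^+ 19 * (z * f ^+ 2) by ring.
by rewrite -z1_rel_z; ring.
Qed.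

Lemma phi_phi_tuple : phi e (phi e v) = scal (e ^+ 3 * f ^+ 21) v.
Proof.
rewrite {1}/phi x3_phi cub_phi x2_phi z2_phi /scal /v.
by congr (_, _, _); ring.
Qed.
End Relations.

Lemma phi_phi e v : phi e (phi e v) = scal (e ^+ 3 * cub e v ^+ 21) v.
Proof. by case: v => [[x y] z]; exact: phi_phi_tuple. Qed.
Lemma cubphi e v : cub e (phi e v) = e * cub e v ^+ 8.
Proof. by case: v => [[x y] z]; exact: cub_phi. Qed.
Lemma oct_phi e v : oct e (phi e v) = e ^+ 3 * cub e v ^+ 21 * lin e v.
Proof. by rewrite /oct phi_phi lin_scal. Qed.
End Cremona.

(** * The isomorphism between the complements *)

Section Involution.
Variable R : comNzRingType.
Implicit Types (e : R) (v : R * R * R).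

(* In the coordinates [x, y, l] with [l = lin e v], this is
   [(y l - s, x l + s, l^2)], [s = (1 - e) (x + y)^2]: as the cubic has degree
   two along the lines through its point of tangency with [l = 0], swapping the
   two points on each of them is polynomial. It fixes the node and exchanges
   its branches. *)
Definition alpha e v : R * R * R := let: (x, y, z) := v in
  let l := lin e v in let s := (1 - e) * (x + y) ^+ 2 in
  (y * l - s, x * l + s, l ^+ 2 - (1 + 2 * e) * (x * l + s) - (2 + e) * (y * l - s)).
(** The factors [e] make the swap carry the cubic of e to a multiple of the cubic of 1/e and at the
    same time fix [lin]. *)
Definition beta e v : R * R * R := let: (x, y, z) := v in (e * y, e * x, z).
(* [trans] is regular off [cub = 0]; each coordinate is divisible by
   [cub ^ 21], and [tloc] is the quotient up to the factor [kap]
   ([kap_trans]). [kap] does not vanish at the points of [cub = 0] outside the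
   octic ([oct_cub_eq0]). *)
Definition trans e e' v := phi e' (beta e (alpha e (phi e v))).

Lemma lin_alpha e v : lin e (alpha e v) = lin e v ^+ 2.
Proof. by case: v => [[x y] z]; rewrite /lin /alpha /=; ring. Qed.
Lemma cub_alpha e v : cub e (alpha e v) = lin e v ^+ 3 * cub e v.
Proof. by case: v => [[x y] z]; rewrite /cub /alpha /lin; ring. Qed.
Lemma alphaK e v : alpha e (alpha e v) = scal (lin e v ^+ 3) v.
Proof.
have l := lin_alpha e v; case: v l => [[x y] z] /= l.
rewrite {}l /scal; congr (_, _, _); ring.
Qed.
Lemma alpha_scal e c v : alpha e (scal c v) = scal (c ^+ 2) (alpha e v).
Proof.
by case: v => [[x y] z]; rewrite /alpha /scal /=; congr (_, _, _); ring.
Qed.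
Lemma beta_scal e c v : beta e (scal c v) = scal c (beta e v).
Proof. by case: v => [[x y] z]; rewrite /beta /scal; congr (_, _, _); ring. Qed.

Section Inverse.
Variables e e' : R.
Hypothesis ee' : e * e' = 1.

Lemma lin_beta v : lin e' (beta e v) = lin e v.
Proof.
case: v => [[x y] z]; rewrite /lin /beta.
have -> : z + (1 + 2 * e') * (e * x) + (2 + e') * (e * y)
  = z + (e + 2 * (e * e')) * x + (2 * e + e * e') * y by ring.
by rewrite ee'; ring.
Qed.
Lemma cub_beta v : cub e' (beta e v) = e ^+ 2 * cub e v.
Proof.
case: v => [[x y] z]; rewrite /cub /beta.
have -> : e' * (e * x) ^+ 3 = e * e' * e ^+ 2 * x ^+ 3 by ring.
by rewrite ee'; ring.
Qed.
Lemma alpha_beta v : beta e' (alpha e' (beta e v)) = alpha e v.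
Proof.
have l := lin_beta v; case: v l => [[x y] z] /= l; rewrite {}l.
set l := _ + _ * x.
have E : (1 - e') * (e * y + e * x) ^+ 2 = - (e * ((1 - e) * (x + y) ^+ 2)).
  have -> : (1 - e') * (e * y + e * x) ^+ 2
     = e * (e - e * e') * (x + y) ^+ 2 by ring.
  by rewrite ee'; ring.
rewrite E; congr (_, _, _).
- have -> : e' * (e * y * l + - (e * ((1 - e) * (x + y) ^+ 2)))
    = (e * e') * (y * l - (1 - e) * (x + y) ^+ 2) by ring.
  by rewrite ee'; ring.
- have -> : e' * (e * x * l - - (e * ((1 - e) * (x + y) ^+ 2)))
    = (e * e') * (x * l + (1 - e) * (x + y) ^+ 2) by ring.
  by rewrite ee'; ring.
set s := (1 - e) * _ ^+ 2.
have -> : l ^+ 2 - (1 + 2 * e') * (e * y * l + - (e * s))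
   - (2 + e') * (e * x * l - - (e * s))
  = l ^+ 2 - (e + 2 * (e * e')) * (y * l - s)
    - (2 * e + e * e') * (x * l + s) by ring.
by rewrite ee'; ring.
Qed.

Lemma cub_beta_alpha_phi v :
  cub e' (beta e (alpha e (phi e v))) = e ^+ 3 * oct e v ^+ 3 * cub e v ^+ 8.
Proof. by rewrite cub_beta cub_alpha cubphi /oct; ring. Qed.
Lemma lin_beta_alpha_phi v :
  lin e' (beta e (alpha e (phi e v))) = oct e v ^+ 2.
Proof. by rewrite lin_beta lin_alpha. Qed.

Lemma trans_scal c v : trans e e' (scal c v) = scal (c ^+ 128) (trans e e' v).
Proof.
rewrite /trans phi_scal alpha_scal beta_scal phi_scal -!exprM.
by congr scal; congr (_ ^+ _).
Qed.

Definition trans_factor v := e' ^+ 3 * (e ^+ 3 * oct e v ^+ 3 * cub e v ^+ 8) ^+ 21.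

Lemma phi_trans v :
  phi e' (trans e e' v) = scal (trans_factor v) (beta e (alpha e (phi e v))).
Proof. by rewrite /trans phi_phi cub_beta_alpha_phi. Qed.
Lemma cub_trans v :
  cub e' (trans e e' v) = e' * (e ^+ 3 * oct e v ^+ 3 * cub e v ^+ 8) ^+ 8.
Proof. by rewrite /trans cubphi cub_beta_alpha_phi. Qed.
Lemma oct_trans v : oct e' (trans e e' v) = trans_factor v * oct e v ^+ 2.
Proof. by rewrite /trans oct_phi cub_beta_alpha_phi lin_beta_alpha_phi. Qed.
Lemma trans_trans v :
  trans e' e (trans e e' v) =
  scal ((trans_factor v ^+ 2 * oct e v ^+ 3) ^+ 8 * (e ^+ 3 * cub e v ^+ 21)) v.
Proof.
rewrite {1}/trans phi_trans alpha_scal beta_scal alpha_beta alphaK scalA phi_scal.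
by rewrite phi_phi scalA.
Qed.
End Inverse.
End Involution.

(** Vanishing of the 2 x 2 minors: proportionality without division, hence stable under evaluation
    of polynomials. *)
Definition par (R : comNzRingType) (v w : R * R * R) : Prop :=
  let: (x, y, z) := v in let: (x', y', z') := w in
  [/\ x * y' = y * x', x * z' = z * x' & y * z' = z * y'].

(** * Dividing out the cubic from the composite map *)

Section Resolution.
Variable R : comNzRingType.
Implicit Types (e : R) (v : R * R * R).

(** [cub * tt_] is the sum of the first two coordinates of [phi]. Next, [yy_] and [xx_] are the
    first two coordinates of [beta (alpha (phi v))] freed from [cub] and [cub ^ 2]
    ([beta_alpha_phiE]), and [n1_], [n2_], [n3_] are the numerators of [x2_], [x3_], [z2_] at that
    point, the denominators being monomials in [xx_], [yy_] and [n1_]. *)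
Definition tt_ e v := x3_ e v + x2_ v * cub e v.
Definition xx_ e v := let: (x, y, z) := v in
  x3_ e v ^+ 2 + 3 * x2_ v * x3_ e v * cub e v + 3 * x2_ v ^+ 2 * cub e v ^+ 2
  + y * cub e v ^+ 3.
Definition yy_ e v := x3_ e v * oct e v + (1 - e) * cub e v * tt_ e v ^+ 2.
Definition n1_ e v := oct e v ^+ 3 * cub e v ^+ 2 + e ^+ 2 * xx_ e v ^+ 3.
Definition n2_ e v := oct e v ^+ 6 * cub e v * yy_ e v ^+ 3 + n1_ e v ^+ 3.
Definition n3_ e v :=
  e ^+ 2 * oct e v ^+ 9 * xx_ e v ^+ 3 * yy_ e v ^+ 6 + n2_ e v ^+ 2.
Definition kap e v := xx_ e v ^+ 2 * yy_ e v ^+ 5 * n1_ e v.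
Definition tloc e v : R * R * R :=
  (e * oct e v ^+ 3 * n1_ e v * n2_ e v * xx_ e v * yy_ e v ^+ 2,
   e ^+ 2 * oct e v ^+ 6 * n1_ e v ^+ 2 * xx_ e v ^+ 2 * yy_ e v ^+ 4,
   n3_ e v).

Lemma octE e v : oct e v =
  z2_ e v + (1 + 2 * e) * (x2_ v * cub e v ^+ 2) + (2 + e) * (x3_ e v * cub e v).
Proof. by []. Qed.

(** By [z2_rel] the product [x2_ * z2_] is x3^2 plus a multiple of e; the terms without e then
    cancel, which explains the shape of [xx_]. *)
Lemma xx_oct e v : e * xx_ e v = x2_ v * oct e v - (1 - e) * tt_ e v ^+ 2.
Proof.
rewrite octE /tt_.
have -> : x2_ v * (z2_ e v + (1 + 2 * e) * (x2_ v * cub e v ^+ 2)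
   + (2 + e) * (x3_ e v * cub e v)) = x2_ v * z2_ e v
   + (1 + 2 * e) * x2_ v ^+ 2 * cub e v ^+ 2 + (2 + e) * x2_ v * x3_ e v * cub e v.
  by ring.
case: v => [[x y] z]; rewrite z2_rel /xx_.
by move: (cub e _) (x2_ _) (x3_ e _) => f p q; ring.
Qed.
Lemma beta_alpha_phiE e v : beta e (alpha e (phi e v)) =
  (e * cub e v * yy_ e v, e ^+ 2 * cub e v ^+ 2 * xx_ e v,
   oct e v ^+ 2 - (1 + 2 * e) * (cub e v * yy_ e v)
     - (2 + e) * (e * cub e v ^+ 2 * xx_ e v)).
Proof.
have -> : beta e (alpha e (phi e v)) =
  (e * (x3_ e v * cub e v * oct e v + (1 - e) * (cub e v * tt_ e v) ^+ 2),
   e * (x2_ v * cub e v ^+ 2 * oct e v - (1 - e) * (cub e v * tt_ e v) ^+ 2),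
   oct e v ^+ 2 -
   (1 + 2 * e) * (x3_ e v * cub e v * oct e v + (1 - e) * (cub e v * tt_ e v) ^+ 2)
   - (2 + e) * (x2_ v * cub e v ^+ 2 * oct e v - (1 - e) * (cub e v * tt_ e v) ^+ 2)).
  rewrite /oct /alpha /beta; have -> : phi e v = ((phi e v).1.1, (phi e v).1.2, (phi e v).2).
    by case: (phi e v) => [[]].
  have -> : (phi e v).1.1 + (phi e v).1.2 = cub e v * tt_ e v.
    by rewrite /tt_ /=; ring.
  by [].
have E : x2_ v * cub e v ^+ 2 * oct e v - (1 - e) * (cub e v * tt_ e v) ^+ 2
   = e * cub e v ^+ 2 * xx_ e v.
  have -> : e * cub e v ^+ 2 * xx_ e v = cub e v ^+ 2 * (e * xx_ e v) by ring.
  by rewrite xx_oct; ring.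
have E' : x3_ e v * cub e v * oct e v + (1 - e) * (cub e v * tt_ e v) ^+ 2
   = cub e v * yy_ e v by rewrite /yy_; ring.
by rewrite E E'; congr (_, _, _); ring.
Qed.
End Resolution.

Section ResolutionDomain.
Variable R : idomainType.
Variables e e' : R.
Hypothesis ee' : e * e' = 1.
Implicit Types v : R * R * R.

Let e0 : e != 0.
Proof. by apply/eqP => E; move/eqP: ee'; rewrite E mul0r eq_sym oner_eq0. Qed.
Let e'0 : e' != 0.
Proof. by apply/eqP => E; move/eqP: ee'; rewrite E mulr0 eq_sym oner_eq0. Qed.

Lemma kap_trans v : cub e v != 0 ->
  scal (kap e v) (trans e e' v) = scal (e ^+ 6 * cub e v ^+ 21) (tloc e v).
Proof.
(* The three exchange relations at [beta (alpha (phi v))] give the exact power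
   of [cub] in each coordinate. *)
move=> f0; rewrite /trans; have C := cub_beta_alpha_phi ee' v.
move: C; rewrite beta_alpha_phiE; set z := _ ^+ 2 - _ - _.
set x := e * _ * _; set y := e ^+ 2 * _ * _ => C.
have := x2_rel e' x y z; have := x3_rel e' x y z; have := z2_rel e' x y z.
rewrite /phi C /kap /tloc /n3_ /n2_; clear C.
move: (x2_ _) (x3_ e' _) (z2_ e' _) => p q r; rewrite {}/x {}/y /n1_.
move: (cub e v) (oct e v) (xx_ e v) (yy_ e v) f0 => f g a b f0 Er Eq Ep {z}.
set n := g ^+ 3 * _ + _.
have Ep' : b * p = e ^+ 2 * f ^+ 5 * n.
  apply: (mulfI (mulf_neq0 e0 f0)); rewrite [LHS]mulrA Ep.
  have -> : e' * (e ^+ 2 * f ^+ 2 * a) ^+ 3 = e * e' * e ^+ 5 * f ^+ 6 * a ^+ 3 by ring.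
  by rewrite ee' /n; ring.
have Eq' : a * b ^+ 3 * q = e ^+ 4 * f ^+ 13 * (g ^+ 6 * f * b ^+ 3 + n ^+ 3).
  have h : e ^+ 2 * f ^+ 2 != 0 by rewrite mulf_neq0 ?expf_neq0.
  apply: (mulfI h).
  have -> : e ^+ 2 * f ^+ 2 * (a * b ^+ 3 * q) = b ^+ 3 * (e ^+ 2 * f ^+ 2 * a * q) by ring.
  rewrite Eq; set u := _ ^+ 2.
  have -> : b ^+ 3 * (u + p ^+ 3) = b ^+ 3 * u + (b * p) ^+ 3 by ring.
  by rewrite Ep' /u; ring.
set m := g ^+ 6 * f * b ^+ 3 + n ^+ 3 in Eq' *.
have Er' : a ^+ 2 * b ^+ 5 * n * r =
    e ^+ 6 * f ^+ 21 * (e ^+ 2 * g ^+ 9 * a ^+ 3 * b ^+ 6 + m ^+ 2).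
  have h : e ^+ 2 * f ^+ 5 != 0 by rewrite mulf_neq0 ?expf_neq0.
  apply: (mulfI h).
  have -> : e ^+ 2 * f ^+ 5 * (a ^+ 2 * b ^+ 5 * n * r)
    = a ^+ 2 * b ^+ 5 * (e ^+ 2 * f ^+ 5 * n) * r by ring.
  rewrite -Ep'.
  have -> : a ^+ 2 * b ^+ 5 * (b * p) * r = (a * b ^+ 3) ^+ 2 * (p * r) by ring.
  rewrite Er; set u := e' * _ * _ ^+ 3.
  have -> : (a * b ^+ 3) ^+ 2 * (u + q ^+ 2)
    = (a * b ^+ 3) ^+ 2 * u + (a * b ^+ 3 * q) ^+ 2 by ring.
  rewrite Eq' /u.
  have -> : e' * (e ^+ 2 * f ^+ 2 * a) = e * e' * e * f ^+ 2 * a by ring.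
  by rewrite ee'; ring.
rewrite /scal; congr (_, _, _).
- have -> : a ^+ 2 * b ^+ 5 * n * (q * (e ^+ 3 * g ^+ 3 * f ^+ 8))
   = a * b ^+ 2 * n * e ^+ 3 * g ^+ 3 * f ^+ 8 * (a * b ^+ 3 * q) by ring.
  by rewrite Eq'; ring.
- have -> : a ^+ 2 * b ^+ 5 * n * (p * (e ^+ 3 * g ^+ 3 * f ^+ 8) ^+ 2)
   = a ^+ 2 * b ^+ 4 * n * (e ^+ 3 * g ^+ 3 * f ^+ 8) ^+ 2 * (b * p) by ring.
  by rewrite Ep'; ring.
by rewrite Er'.
Qed.

Lemma oct_tloc v : cub e v != 0 ->
  oct e' (tloc e v) = e ^+ 12 * oct e v ^+ 65 * kap e v ^+ 8.
Proof.
move=> f0; have := congr1 (oct e') (kap_trans f0).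
rewrite !oct_scal oct_trans // /trans_factor => E.
have h : (e ^+ 6 * cub e v ^+ 21) ^+ 8 != 0.
  by rewrite expf_neq0 // mulf_neq0 ?expf_neq0.
apply: (mulfI h); rewrite -E.
have -> : e' ^+ 3 * (e ^+ 3 * oct e v ^+ 3 * cub e v ^+ 8) ^+ 21 =
  (e * e') ^+ 3 * e ^+ 60 * oct e v ^+ 63 * cub e v ^+ 168 by ring.
by rewrite ee'; ring.
Qed.

Lemma cub_tloc v : cub e v != 0 ->
  cub e' (tloc e v) = e ^+ 5 * oct e v ^+ 24 * cub e v * kap e v ^+ 3.
Proof.
move=> f0; have := congr1 (cub e') (kap_trans f0).
rewrite !cub_scal cub_trans // => E.
have h : (e ^+ 6 * cub e v ^+ 21) ^+ 3 != 0.
  by rewrite expf_neq0 // mulf_neq0 ?expf_neq0.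
apply: (mulfI h); rewrite -E.
have -> : e' * (e ^+ 3 * oct e v ^+ 3 * cub e v ^+ 8) ^+ 8 =
  (e * e') * e ^+ 23 * oct e v ^+ 24 * cub e v ^+ 64 by ring.
by rewrite ee'; ring.
Qed.

Lemma par_scal a b (v w : R * R * R) : a != 0 -> scal a w = scal b v -> par v w.
Proof.
case: v w => [[x y] z] [[x' y'] z'] a0 [Ex Ey Ez] /=.
split; apply: (mulfI a0); rewrite ![a * (_ * _)]mulrCA ?Ex ?Ey ?Ez; ring.
Qed.
End ResolutionDomain.

(** Off the cubic [tloc] and [trans] differ by scalars, so this is [trans_trans] up to a factor. It
    is meant for the generic point and gets specialized afterwards. *)
Lemma tloc_tloc (R : idomainType) (e e' : R) v : e * e' = 1 ->
  cub e v != 0 -> oct e v != 0 -> kap e v != 0 ->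
  par v (tloc e' (tloc e v)).
Proof.
move=> ee' f0 g0 k0; have e'e : e' * e = 1 by rewrite mulrC.
have e0 : e != 0.
  by apply/eqP => E; move/eqP: ee'; rewrite E mul0r eq_sym oner_eq0.
have e'0 : e' != 0.
  by apply/eqP => E; move/eqP: ee'; rewrite E mulr0 eq_sym oner_eq0.
have c0 : cub e' (tloc e v) != 0.
  rewrite (cub_tloc ee') //; move: (kap e v) (oct e v) (cub e v) k0 g0 f0 => k g f k0 g0 f0.
  by rewrite !mulf_neq0 // expf_neq0.
have E1 := kap_trans e'e c0.
have E2 : scal ((e ^+ 6 * cub e v ^+ 21) ^+ 128) (trans e' e (tloc e v)) =
    scal (kap e v ^+ 128) (trans e' e (trans e e' v)).
  move: (congr1 (trans e' e) (kap_trans ee' f0)).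
  by rewrite (trans_scal e' e (kap e v)) (trans_scal e' e (e ^+ 6 * _)) => ->.
rewrite (trans_trans ee') in E2.
apply: (@par_scal _ ((e ^+ 6 * cub e v ^+ 21) ^+ 128 * (e' ^+ 6 * cub e' (tloc e v) ^+ 21))
  (kap e' (tloc e v) * kap e v ^+ 128 *
   ((trans_factor e e' v ^+ 2 * oct e v ^+ 3) ^+ 8 * (e ^+ 3 * cub e v ^+ 21)))).
  have h n (x : R) : x != 0 -> x ^+ n != 0 by exact: expf_neq0.
  apply: mulf_neq0; first by apply: (h); apply: mulf_neq0; apply: (h).
  by apply: mulf_neq0; apply: (h).
rewrite -[LHS]scalA -E1 scalA (mulrC _ (kap e' (tloc e v))) -[LHS]scalA E2.
by rewrite scalA scalA.
Qed.

(** * Weights and base change *)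

Section Scaling.
Variable R : comNzRingType.
Implicit Types (e c : R) (v : R * R * R).

Lemma tt_scal e c v : tt_ e (scal c v) = c ^+ 5 * tt_ e v.
Proof. by rewrite /tt_ x3_scal x2_scal cub_scal; ring. Qed.
Lemma xx_scal e c v : xx_ e (scal c v) = c ^+ 10 * xx_ e v.
Proof.
rewrite /xx_; have := x3_scal e c v; have := x2_scal c v; have := cub_scal e c v.
by case: v => [[x y] z] -> -> ->; ring.
Qed.
Lemma yy_scal e c v : yy_ e (scal c v) = c ^+ 13 * yy_ e v.
Proof. by rewrite /yy_ x3_scal oct_scal cub_scal tt_scal; ring. Qed.
Lemma n1_scal e c v : n1_ e (scal c v) = c ^+ 30 * n1_ e v.
Proof. by rewrite /n1_ xx_scal oct_scal cub_scal; ring. Qed.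
Lemma n2_scal e c v : n2_ e (scal c v) = c ^+ 90 * n2_ e v.
Proof. by rewrite /n2_ yy_scal oct_scal cub_scal n1_scal; ring. Qed.
Lemma tloc_scal e c v : tloc e (scal c v) = scal (c ^+ 180) (tloc e v).
Proof.
rewrite /tloc /n3_ xx_scal yy_scal n1_scal n2_scal oct_scal /scal.
by move: (n2_ e v) (n1_ e v) (oct e v) (xx_ e v) (yy_ e v) => a b g s t;
   congr (_, _, _); ring.
Qed.
End Scaling.

Section Morphism.
Variables (R S : comNzRingType) (h : {rmorphism R -> S}).
Implicit Types (e c : R) (v : R * R * R).

Definition map3 v : S * S * S := (h v.1.1, h v.1.2, h v.2).

Lemma cub_map e v : cub (h e) (map3 v) = h (cub e v).
Proof. by case: v => [[x y] z]; rewrite /= !(rmorphE, rmorphM). Qed.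
Lemma x2_map v : x2_ (map3 v) = h (x2_ v).
Proof. by case: v => [[x y] z]; rewrite /= !(rmorphE, rmorphM). Qed.
Lemma z1_map e v : z1_ (h e) (map3 v) = h (z1_ e v).
Proof. by case: v => [[x y] z]; rewrite /= !(rmorphE, rmorphM). Qed.
Lemma x3_map e v : x3_ (h e) (map3 v) = h (x3_ e v).
Proof.
have := cub_map e v; have := x2_map v; have := z1_map e v.
case: v => [[x y] z]; rewrite /x3_ => -> -> ->.
by move: (z1_ e _) (x2_ _) (cub e _) => w p f; rewrite !(rmorphE, rmorphM).
Qed.
Lemma z2_map e v : z2_ (h e) (map3 v) = h (z2_ e v).
Proof.
have := cub_map e v; have := x2_map v; have := z1_map e v.
case: v => [[x y] z]; rewrite /z2_ => -> -> ->.
by move: (z1_ e _) (x2_ _) (cub e _) => w p f; rewrite !(rmorphE, rmorphM).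
Qed.
Lemma phi_map e v : phi (h e) (map3 v) = map3 (phi e v).
Proof.
by rewrite /phi x3_map cub_map x2_map z2_map /map3 /= !(rmorphM, rmorphXn).
Qed.
Lemma lin_map e v : lin (h e) (map3 v) = h (lin e v).
Proof. by case: v => [[x y] z]; rewrite /= !(rmorphE, rmorphM). Qed.
Lemma oct_map e v : oct (h e) (map3 v) = h (oct e v).
Proof. by rewrite /oct phi_map lin_map. Qed.
Lemma alpha_map e v : alpha (h e) (map3 v) = map3 (alpha e v).
Proof.
have := lin_map e v; case: v => [[x y] z]; rewrite /alpha => ->.
by move: (lin e _) => l; rewrite /map3 /=; congr (_, _, _); rewrite !(rmorphE, rmorphM).
Qed.
Lemma beta_map e v : beta (h e) (map3 v) = map3 (beta e v).
Proof. by case: v => [[x y] z]; rewrite /map3 /= !rmorphM. Qed.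
Lemma trans_map e e' v : trans (h e) (h e') (map3 v) = map3 (trans e e' v).
Proof. by rewrite /trans phi_map alpha_map beta_map phi_map. Qed.
Lemma tt_map e v : tt_ (h e) (map3 v) = h (tt_ e v).
Proof. by rewrite /tt_ x3_map x2_map cub_map rmorphD rmorphM. Qed.
Lemma xx_map e v : xx_ (h e) (map3 v) = h (xx_ e v).
Proof.
have := cub_map e v; have := x2_map v; have := x3_map e v.
case: v => [[x y] z]; rewrite /xx_ => -> -> ->.
by move: (x3_ e _) (x2_ _) (cub e _) => w p f; rewrite !(rmorphE, rmorphM).
Qed.
Lemma yy_map e v : yy_ (h e) (map3 v) = h (yy_ e v).
Proof.
rewrite /yy_ x3_map oct_map cub_map tt_map.
by move: (x3_ e v) (oct e v) (cub e v) (tt_ e v) => q g f t; rewrite !(rmorphE, rmorphM).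
Qed.
Lemma n1_map e v : n1_ (h e) (map3 v) = h (n1_ e v).
Proof.
rewrite /n1_ xx_map oct_map cub_map.
by move: (xx_ e v) (oct e v) (cub e v) => a g f; rewrite !(rmorphE, rmorphM).
Qed.
Lemma n2_map e v : n2_ (h e) (map3 v) = h (n2_ e v).
Proof.
rewrite /n2_ yy_map oct_map cub_map n1_map.
by move: (yy_ e v) (oct e v) (cub e v) (n1_ e v) => b g f n; rewrite !(rmorphE, rmorphM).
Qed.
Lemma kap_map e v : kap (h e) (map3 v) = h (kap e v).
Proof.
rewrite /kap xx_map yy_map n1_map.
by move: (yy_ e v) (xx_ e v) (n1_ e v) => b a n; rewrite !(rmorphE, rmorphM).
Qed.
Lemma tloc_map e v : tloc (h e) (map3 v) = map3 (tloc e v).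
Proof.
rewrite /tloc /n3_ xx_map oct_map n1_map n2_map yy_map /map3.
by move: (yy_ e v) (xx_ e v) (n1_ e v) (n2_ e v) (oct e v) => b a n m g;
   congr (_, _, _); rewrite !(rmorphE, rmorphM).
Qed.
Lemma scal_map c v : scal (h c) (map3 v) = map3 (scal c v).
Proof. by case: v => [[x y] z]; rewrite /map3 /= !rmorphM. Qed.
Lemma par_map v w : par v w -> par (map3 v) (map3 w).
Proof.
by case: v w => [[x y] z] [[x' y'] z'] [a b c]; split; rewrite -!rmorphM /= (a, b, c).
Qed.
End Morphism.

Section Coordinates.
Variable k : fieldType.
Implicit Types (v : 'cV[k]_3) (t : k * k * k).

Definition comp3 (T : Type) (t : T * T * T) (i : 'I_3) : T :=
  match val i with 0%N => t.1.1 | 1%N => t.1.2 | _ => t.2 end.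
Definition tr v : k * k * k := (v 0 0, v 1 0, v ord_max 0).
Definition col3 t : 'cV[k]_3 := \col_i comp3 t i.
Definition X3 : {mpoly k[3]} * {mpoly k[3]} * {mpoly k[3]} :=
  ('X_0, 'X_1, 'X_ord_max).

Lemma ord3P (i : 'I_3) : [\/ i = 0, i = 1 | i = ord_max].
Proof.
case: i => [[|[|[|//]]] h]; [constructor 1|constructor 2|constructor 3]; exact: val_inj.
Qed.
Lemma tr_col3 t : tr (col3 t) = t.
Proof. by case: t => [[x y] z]; rewrite /tr !mxE. Qed.
Lemma tr_inj : injective tr.
Proof.
move=> u v [E0 E1 E2]; apply/colP => i.
by case: (ord3P i) => ->.
Qed.
Lemma col3_tr v : col3 (tr v) = v.
Proof. by apply: tr_inj; rewrite tr_col3. Qed.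
Lemma tr_scale c v : tr (c *: v) = scal c (tr v).
Proof. by rewrite /tr !mxE. Qed.
Lemma col_scal c t : col3 (scal c t) = c *: col3 t.
Proof. by apply: tr_inj; rewrite tr_scale !tr_col3. Qed.
Lemma tr_eq0 v : (tr v == (0, 0, 0)) = (v == 0).
Proof.
apply/eqP/eqP => [E|->]; last by rewrite /tr !mxE.
by apply: tr_inj; rewrite E /tr !mxE.
Qed.
End Coordinates.

Section Dilation.
Variables (n : nat) (R : comNzRingType).
Implicit Types P : {mpoly R[n]}.

Definition dil_coef : R -> {poly {mpoly R[n]}} := polyC \o @mpolyC n R.
Definition dil_var (i : 'I_n) : {poly {mpoly R[n]}} := 'X * ('X_i)%:P.
HB.instance Definition _ := GRing.RMorphism.copy dil_coef (polyC \o @mpolyC n R).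
(** Substitutes t X_i for X_i. Homogeneity of degree d becomes the identity [dil P = t^d P], which
    the scaling lemmas provide over [{poly {mpoly R[n]}}]. *)
Definition dil : {rmorphism {mpoly R[n]} -> {poly {mpoly R[n]}}} :=
  mmap dil_coef dil_var.

Lemma dil_mnm m : mmap1 dil_var m = ('X_[m])%:P * 'X^(mdeg m).
Proof.
rewrite /mmap1 mdegE (eq_bigr (fun i => 'X^(m i) * ('X_i ^+ m i)%:P)) => [|i _]; last first.
  by rewrite /dil_var exprMn polyC_exp.
rewrite big_split /= mulrC -rmorph_prod -expr_sum; congr (_%:P * _).
by rewrite mpolyXE_id.
Qed.

Lemma coef_dil P i m : ((dil P)`_i)@_m = if mdeg m == i then P@_m else 0.
Proof.
elim/mpolyind: P => [|c m' P _ _ IH].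
  by rewrite raddf0 coef0 !mcoeff0; case: ifP.
have E : dil (c *: 'X_[m']) = (c *: 'X_[m'])%:P * 'X^(mdeg m').
  have -> : dil (c *: 'X_[m']) = dil_coef c * mmap1 dil_var m'.
    by rewrite -(mmapX dil_var dil_coef); exact: mmapZ.
  rewrite dil_mnm mulrA; congr (_ * _).
  by rewrite -mul_mpolyC polyCM.
have -> : dil (c *: 'X_[m'] + P) = dil (c *: 'X_[m']) + dil P by exact: raddfD.
have am : (c *: 'X_[m'])@_m = c * (m' == m)%:R by rewrite mcoeffZ mcoeffX.
rewrite {}E; move: (c *: 'X_[m']) am => a am.
rewrite coefD coefCM coefXn 2!mcoeffD IH {IH} eq_sym.
move: (dil P)`_i => b; case: (altP (m' =P m)) am => [->|_]; rewrite ?mulr0 => am.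
  by case: eqP => _; rewrite ?mulr1 ?mulr0 // mcoeff0 !add0r.
by case: eqP => _; rewrite ?mulr1 ?mulr0 ?mcoeff0 ?am !add0r.
Qed.

Lemma dhomog_dil P d : dil P = 'X^d * P%:P -> P \is d.-homog.
Proof.
move=> E; apply/dhomogP => m; rewrite mcoeff_msupp => Pm.
have := coef_dil P (mdeg m) m; rewrite eqxx E coefXnM.
case: ltnP => [_|le]; first by rewrite mcoeff0 => h; rewrite -h eqxx in Pm.
rewrite coefC subn_eq0; case: leqP => [le' _|_]; first by apply/eqP; rewrite eqn_leq le'.
by rewrite mcoeff0 => h; rewrite -h eqxx in Pm.
Qed.
End Dilation.

(** * The isomorphism on points, and its regularity *)

Section Complement.
Variable k : closedFieldType.
Implicit Types (e : k) (v : 'cV[k]_3).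

Definition octic e : {mpoly k[3]} := oct e%:MP (X3 k).

Lemma dil_X3 : map3 (dil 3 k) (X3 k) = scal 'X (map3 polyC (X3 k)).
Proof. by rewrite /map3 /scal; congr (_, _, _); rewrite [LHS]mmapX mmap1U. Qed.
Lemma dil_C e : dil 3 k e%:MP_[3] = e%:MP%:P.
Proof. exact: mmapC. Qed.

Lemma homog_oct e : octic e \is 8.-homog.
Proof. by apply: dhomog_dil; rewrite -oct_map dil_X3 dil_C oct_scal oct_map. Qed.

Lemma homog_coord d (t : {mpoly k[3]} * {mpoly k[3]} * {mpoly k[3]}) :
  map3 (dil 3 k) t = scal ('X^d) (map3 polyC t) ->
  forall i, comp3 t i \is d.-homog.
Proof.
case: t => [[x y] z] [Ex Ey Ez] i; apply: dhomog_dil.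
by case: (ord3P i) => ->; [exact: Ex | exact: Ey | exact: Ez].
Qed.

Definition evm v : {rmorphism {mpoly k[3]} -> k} := meval (fun i => v i 0).
Lemma evmC v c : evm v c%:MP = c.
Proof. exact: mevalC. Qed.
Lemma evm_X3 v : map3 (evm v) (X3 k) = tr v.
Proof. by congr (_, _, _); exact: mevalXU. Qed.
Lemma evH_comp3 t v : evH (comp3 t) v = col3 (map3 (evm v) t).
Proof. by apply/colP => i; rewrite !mxE; case: (ord3P i) => ->. Qed.
Lemma evm_octic e v : evm v (octic e) = oct e (tr v).
Proof. by rewrite -evm_X3 -{2}(evmC v e) oct_map. Qed.
Lemma ev_octic e v : ev (octic e) v = oct e (tr v).
Proof. exact: evm_octic. Qed.

Lemma par_proj_eq u v : u != 0 -> v != 0 -> par (tr u) (tr v) -> proj_eq u v.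
Proof.
move=> u0 v0 [E1 E2 E3].
have uE i j : u i 0 * v j 0 = u j 0 * v i 0.
  case: (ord3P i) (ord3P j) => [] -> [] -> //; exact: esym.
have vP : exists j, v j 0 != 0.
  apply/existsP; apply: contraNT v0; rewrite negb_exists => /forallP h.
  by apply/eqP/colP => j; rewrite mxE; apply/eqP; have := h j; rewrite negbK.
case: vP => j vj; exists (u j 0 / v j 0); last first.
  apply/colP => i; rewrite mxE; apply: (mulIf vj).
  by rewrite [RHS]mulrAC divfK.
apply: contra u0; rewrite mulf_eq0 invr_eq0 (negPf vj) orbF => /eqP uj.
by apply/eqP/colP => i; rewrite mxE; apply: (mulIf vj); rewrite uE uj !mul0r.
Qed.
Lemma proj_eq_scal c u v : c != 0 -> tr u = scal c (tr v) -> proj_eq u v.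
Proof. by move=> c0 E; exists c => //; apply: tr_inj; rewrite E tr_scale. Qed.
Lemma proj_eq_sym u v : proj_eq u v -> proj_eq v u.
Proof.
case=> c c0 ->; exists c^-1; first by rewrite invr_eq0.
by rewrite scalerA mulVf // scale1r.
Qed.

Lemma oct000 e : oct e (0, 0, 0) = 0.
Proof.
have := oct_scal e 0 (0, 0, 0); rewrite /scal !mulr0 => ->.
by rewrite expr0n mul0r.
Qed.
Lemma in_compl_octic e v : in_compl (octic e) v <-> oct e (tr v) != 0.
Proof.
rewrite /in_compl ev_octic; split=> [[] // | h]; split=> //.
by apply: contra h => /eqP ->; rewrite /tr !mxE oct000.
Qed.

Lemma cubX_neq0 e : cub e%:MP (X3 k) != 0.
Proof.
apply/eqP => /(congr1 (evm (col3 (1, 0, 0)))).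
rewrite -cub_map evmC evm_X3 tr_col3 rmorph0.
have -> : cub e (1, 0, 0) = - 1 by rewrite /cub; ring.
by move/eqP; rewrite oppr_eq0 oner_eq0.
Qed.

(** On the cubic the exchange relations read y q = p^3 and x p = e y^3: q = 0 gives p = 0, then y =
    0, and p = y z - x^2 gives x = 0. *)
Lemma cub_x3_eq0 e x y z : e != 0 -> cub e (x, y, z) = 0 ->
  x3_ e (x, y, z) = 0 -> x = 0 /\ y = 0.
Proof.
move=> e0 f0 q0; have := x3_rel e x y z; rewrite f0 q0 mulr0 expr0n add0r.
move=> /esym/eqP; rewrite expf_eq0 => /andP[_ /eqP p0].
have := x2_rel e x y z; rewrite p0 f0 mulr0 add0r => /esym/eqP.
rewrite mulf_eq0 (negPf e0) expf_eq0 => /andP[_ /eqP y0]; split=> //.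
move: p0; rewrite y0 /x2_ mul0r sub0r => /eqP.
by rewrite oppr_eq0 expf_eq0 => /andP[_ /eqP].
Qed.
Lemma oct00 e z : oct e (0, 0, z) = 0.
Proof. by rewrite /oct /lin /phi /x3_ /x2_ /z2_ /z1_ /cub /x2_; ring. Qed.
Lemma octP e t : oct e t =
  z2_ e t + cub e t * ((1 + 2 * e) * (x2_ t * cub e t) + (2 + e) * x3_ e t).
Proof. by rewrite octE; ring. Qed.
(** On the cubic [oct] equals [z2_], and p z2 = q^2. So the octic meets the cubic only at the node,
    which therefore is its only candidate for a singular point. *)
Lemma cub_oct_eq0 e x y z : e != 0 -> cub e (x, y, z) = 0 ->
  oct e (x, y, z) = 0 -> x = 0 /\ y = 0.
Proof.
move=> e0 f0; rewrite octP f0 mul0r addr0 => r0.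
apply: (cub_x3_eq0 e0 f0); have := z2_rel e x y z.
rewrite r0 f0 mulr0 expr0n mulr0 add0r => /esym/eqP.
by rewrite expf_eq0 => /andP[_ /eqP].
Qed.
(** At cub = 0 the factors of [kap] become q^2, q oct and e^2 q^6, where q is [x3_]. *)
Lemma oct_cub_eq0 e t : e != 0 -> cub e t = 0 -> oct e t != 0 -> kap e t != 0.
Proof.
move=> e0; case: t => [[x y] z] f0 g0.
have q0 : x3_ e (x, y, z) != 0.
  apply: contra g0 => /eqP q0; have [-> ->] := cub_x3_eq0 e0 f0 q0.
  by rewrite oct00.
have a0 : xx_ e (x, y, z) != 0.
  by rewrite /xx_ f0 !expr0n !(mulr0, addr0) expf_neq0.
have b0 : yy_ e (x, y, z) != 0.
  by rewrite /yy_ f0 mulr0 mul0r addr0 mulf_neq0.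
have n0 : n1_ e (x, y, z) != 0.
  by rewrite /n1_ f0 expr0n mulr0 add0r mulf_neq0 ?expf_neq0.
rewrite /kap; move: (xx_ _ _) (yy_ _ _) (n1_ _ _) a0 b0 n0 => a b n a0 b0 n0.
by rewrite !mulf_neq0 ?expf_neq0.
Qed.

Section Isomorphism.
Variables e e' : k.
Hypothesis ee' : e * e' = 1.
Let e0 : e != 0.
Proof. by apply/eqP => E; move/eqP: ee'; rewrite E mul0r eq_sym oner_eq0. Qed.
Let e'0 : e' != 0.
Proof. by apply/eqP => E; move/eqP: ee'; rewrite E mulr0 eq_sym oner_eq0. Qed.
Let ee'C : e%:MP_[3] * e'%:MP_[3] = 1.
Proof. by rewrite -mpolyCM ee'. Qed.

(** The two formulas are proportional wherever [tloc] is nonzero ([iso_map_tloc]), so the case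
    distinction defines a single morphism. *)
Definition iso_map (v : 'cV[k]_3) : 'cV[k]_3 :=
  col3 (if cub e (tr v) != 0 then trans e e' (tr v) else tloc e (tr v)).

Let rmorph3 (h : {rmorphism {mpoly k[3]} -> k}) a b c l m n :
  h (a ^+ l * b ^+ m * c ^+ n) = h a ^+ l * h b ^+ m * h c ^+ n.
Proof. by rewrite !rmorphM !rmorphXn. Qed.
Let rmorph4 (h : {rmorphism {mpoly k[3]} -> k}) a b c d l m n :
  h (a ^+ l * b ^+ m * c * d ^+ n) = h a ^+ l * h b ^+ m * h c * h d ^+ n.
Proof. by rewrite !rmorphM !rmorphXn. Qed.
Lemma tr_iso_map_trans v : cub e (tr v) != 0 -> tr (iso_map v) = trans e e' (tr v).
Proof. by move=> f0; rewrite tr_col3 f0. Qed.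
Lemma tr_iso_map_tloc v : cub e (tr v) = 0 -> tr (iso_map v) = tloc e (tr v).
Proof. by move=> f0; rewrite tr_col3 f0 eqxx. Qed.
(* On [cub = 0] the factor [cub] cannot be cancelled pointwise, so the
   identities are proved for polynomials and then evaluated. *)
Lemma oct_tloc_pt t : oct e' (tloc e t) = e ^+ 12 * oct e t ^+ 65 * kap e t ^+ 8.
Proof.
have := congr1 (evm (col3 t)) (oct_tloc ee'C (cubX_neq0 e)).
rewrite -oct_map -tloc_map evm_X3 tr_col3 !evmC => ->.
by rewrite rmorph3 -oct_map -kap_map evm_X3 tr_col3 evmC.
Qed.
Lemma cub_tloc_pt t :
  cub e' (tloc e t) = e ^+ 5 * oct e t ^+ 24 * cub e t * kap e t ^+ 3.
Proof.
have := congr1 (evm (col3 t)) (cub_tloc ee'C (cubX_neq0 e)).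
rewrite -cub_map -tloc_map evm_X3 tr_col3 !evmC => ->.
by rewrite rmorph4 -oct_map -cub_map -kap_map evm_X3 tr_col3 evmC.
Qed.
Lemma tloc_tloc_pt t : oct e t != 0 -> kap e t != 0 -> par t (tloc e' (tloc e t)).
Proof.
move=> g0 k0; pose h := evm (col3 t).
have hX : map3 h (X3 k) = t by rewrite evm_X3 tr_col3.
have hC c : h c%:MP = c by exact: evmC.
have G0 : oct e%:MP (X3 k) != 0.
  by apply: contra g0 => /eqP E; rewrite -hX -(hC e) oct_map E rmorph0.
have K0 : kap e%:MP (X3 k) != 0.
  by apply: contra k0 => /eqP E; rewrite -hX -(hC e) kap_map E rmorph0.
have := par_map h (tloc_tloc ee'C (cubX_neq0 e) G0 K0).
by rewrite -!tloc_map !hX !hC.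
Qed.

Lemma iso_map_octic v : oct e (tr v) != 0 -> oct e' (tr (iso_map v)) != 0.
Proof.
move=> g0; rewrite tr_col3; case: ifP => [f0|/negbT]; last first.
  rewrite negbK => /eqP f0; rewrite oct_tloc_pt.
  have := oct_cub_eq0 e0 f0 g0; move: (kap _ _) (oct _ _) g0 => a b b0 a0.
  by rewrite !mulf_neq0 ?expf_neq0.
rewrite oct_trans // /trans_factor; move: (oct _ _) (cub _ _) g0 f0 => g f g0 f0.
by rewrite !mulf_neq0 ?expf_neq0 // !mulf_neq0 ?expf_neq0.
Qed.

(** Hence a round trip uses the same formula both ways: [trans] twice or [tloc] twice. *)
Lemma cub_iso_map v : oct e (tr v) != 0 ->
  (cub e' (tr (iso_map v)) != 0) = (cub e (tr v) != 0).
Proof.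
move=> g0; rewrite tr_col3; case: ifP => [f0|/negbT]; last first.
  by rewrite negbK => /eqP f0; rewrite cub_tloc_pt f0 mulr0 mul0r eqxx.
rewrite cub_trans //; move: (oct _ _) (cub _ _) g0 f0 => g f g0 f0.
by rewrite !mulf_neq0 ?expf_neq0 // !mulf_neq0 ?expf_neq0.
Qed.

Definition trans_poly := trans e%:MP_[3] e'%:MP_[3] (X3 k).
Definition tloc_poly := tloc e%:MP_[3] (X3 k).
Lemma evH_trans v : evH (comp3 trans_poly) v = col3 (trans e e' (tr v)).
Proof. by rewrite evH_comp3 -trans_map !evmC evm_X3. Qed.
Lemma evH_tloc v : evH (comp3 tloc_poly) v = col3 (tloc e (tr v)).
Proof. by rewrite evH_comp3 -tloc_map !evmC evm_X3. Qed.
Lemma homog_trans i : comp3 trans_poly i \is 128.-homog.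
Proof.
by apply: homog_coord; rewrite -trans_map dil_X3 !dil_C trans_scal trans_map.
Qed.
Lemma homog_tloc i : comp3 tloc_poly i \is 180.-homog.
Proof.
by apply: homog_coord; rewrite -tloc_map dil_X3 !dil_C tloc_scal tloc_map.
Qed.
Lemma col3_eq0 (t : k * k * k) : (col3 t == 0) = (t == (0, 0, 0)).
Proof. by rewrite -tr_eq0 tr_col3. Qed.
(** Consequently, wherever the representative of degree 128 is nonzero, the point is off the cubic
    and [iso_map] is given by that representative. *)
Lemma trans_eq0 t : cub e t = 0 -> trans e e' t = (0, 0, 0).
Proof.
move=> f0; have E : phi e t = (0, 0, z2_ e t).
  by rewrite /phi f0 mulr0 expr0n mulr0.
rewrite /trans E /alpha /beta /phi /=.
by congr (_, _, _); ring.
Qed.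

Lemma iso_map_proj u v : oct e (tr v) != 0 -> proj_eq u v ->
  proj_eq (iso_map u) (iso_map v).
Proof.
move=> g0 [c c0 ->]; rewrite /iso_map tr_scale.
have -> : (cub e (scal c (tr v)) != 0) = (cub e (tr v) != 0).
  by rewrite cub_scal mulf_eq0 expf_eq0 (negPf c0).
case: ifP => _.
  exists (c ^+ 128); first by rewrite expf_neq0.
  by rewrite trans_scal col_scal.
exists (c ^+ 180); first by rewrite expf_neq0.
by rewrite tloc_scal col_scal.
Qed.

Let scal_eq0 (c : k) (t : k * k * k) : c != 0 -> scal c t = (0, 0, 0) -> t = (0, 0, 0).
Proof.
move=> c0; case: t => [[x y] z] [] /eqP Ex /eqP Ey /eqP Ez.
move: Ex Ey Ez; rewrite !mulf_eq0 (negPf c0) => /eqP -> /eqP -> /eqP ->.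
by [].
Qed.
Lemma iso_map_tloc v : tloc e (tr v) != (0, 0, 0) ->
  proj_eq (iso_map v) (col3 (tloc e (tr v))).
Proof.
move=> l0; rewrite /iso_map; case: ifP => [f0|_]; last first.
  by exists 1; rewrite ?oner_eq0 ?scale1r.
have c0 : e ^+ 6 * cub e (tr v) ^+ 21 != 0 by rewrite mulf_neq0 ?expf_neq0.
have := kap_trans ee' f0; move: (e ^+ 6 * _) c0 => c c0 E.
have K0 : kap e (tr v) != 0.
  apply: contra l0 => /eqP K0; apply/eqP/(scal_eq0 c0).
  by rewrite -E K0; case: (trans _ _ _) => [[x y] z]; rewrite /scal !mul0r.
apply: (@proj_eq_scal (c / kap e (tr v))); first by rewrite mulf_neq0 ?invr_eq0.
rewrite !tr_col3 [_ / _]mulrC -scalA -E scalA mulVf //.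
by case: (trans _ _ _) => [[x y] z]; rewrite /scal !mul1r.
Qed.

Lemma iso_map_regular : regular_map (octic e) (octic e') iso_map.
Proof.
split.
- by move=> v /in_compl_octic/iso_map_octic/in_compl_octic.
- by move=> u v /in_compl_octic; apply: iso_map_proj.
move=> v /in_compl_octic g0.
have [f0|f0] := eqVneq (cub e (tr v)) 0.
- exists 180, (comp3 tloc_poly); split; first exact: homog_tloc.
    rewrite evH_tloc col3_eq0; apply/eqP => E.
    have := iso_map_octic g0; rewrite /iso_map f0 eqxx /= tr_col3 E oct000.
    by rewrite eqxx.
  by move=> q _; rewrite evH_tloc col3_eq0; apply: iso_map_tloc.
exists 128, (comp3 trans_poly); split; first exact: homog_trans.
  rewrite evH_trans col3_eq0; apply/eqP => E.
  have := iso_map_octic g0; rewrite /iso_map f0 /= tr_col3 E oct000.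
  by rewrite eqxx.
move=> q _; rewrite evH_trans col3_eq0 => s0; rewrite /iso_map.
have [f1|_] := eqVneq (cub e (tr q)) 0; first by move: s0; rewrite trans_eq0 // eqxx.
by exists 1; rewrite ?oner_eq0 ?scale1r.
Qed.
End Isomorphism.

Lemma iso_mapK e e' v : e * e' = 1 -> oct e (tr v) != 0 ->
  proj_eq (iso_map e' e (iso_map e e' v)) v.
Proof.
move=> ee' g0; have e'e : e' * e = 1 by rewrite mulrC.
have v0 : v != 0 by have /in_compl_octic[] := g0.
have h1 := iso_map_octic ee' g0; have h2 := iso_map_octic e'e h1.
have := cub_iso_map ee' g0.
have [f0|f0] := eqVneq (cub e (tr v)) 0.
  move/negbT; rewrite negbK => /eqP f1.
  apply/proj_eq_sym/par_proj_eq => //.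
    by have /in_compl_octic[] := h2.
  rewrite (tr_iso_map_tloc _ f1) (tr_iso_map_tloc _ f0).
  apply: tloc_tloc_pt => //; apply: oct_cub_eq0 => //.
  by apply/eqP => E; move/eqP: ee'; rewrite E mul0r eq_sym oner_eq0.
move=> f1; have E := trans_trans ee' (tr v).
have E' : tr (iso_map e' e (iso_map e e' v)) = trans e' e (trans e e' (tr v)).
  by rewrite (tr_iso_map_trans _ f1) (tr_iso_map_trans _ f0).
rewrite E in E'.
have c0 : (trans_factor e e' (tr v) ^+ 2 * oct e (tr v) ^+ 3) ^+ 8 *
  (e ^+ 3 * cub e (tr v) ^+ 21) != 0.
  apply/eqP => c0; move: h2; rewrite E' c0.
  by rewrite oct_scal expr0n mul0r eqxx.
exact: proj_eq_scal c0 E'.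
Qed.

Lemma octic_compl_isomorphic e e' : e * e' = 1 ->
  compl_isomorphic (octic e) (octic e').
Proof.
move=> ee'; have e'e : e' * e = 1 by rewrite mulrC.
exists (iso_map e e'), (iso_map e' e); split; try exact: iso_map_regular.
- by move=> v /in_compl_octic; apply: iso_mapK.
- by move=> v /in_compl_octic; apply: iso_mapK.
Qed.
End Complement.

(** * Arcs and smoothness *)

Section Arcs.
Variables (n : nat) (k : comNzRingType).
Implicit Types (P : {mpoly k[n]}) (g : 'I_n -> {poly k}).

Definition parc g : {rmorphism {mpoly k[n]} -> {poly k}} := mmap polyC g.

Lemma arcC g c : parc g c%:MP = c%:P. Proof. exact: mmapC. Qed.
Lemma arcX g i : parc g 'X_i = g i.
Proof. by rewrite [LHS]mmapX mmap1U. Qed.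

Lemma horner_arc g P x : (parc g P).[x] = P.@[fun i => (g i).[x]].
Proof.
rewrite mevalE /= /mmap horner_sum; apply: eq_bigr => m _.
rewrite hornerM hornerC; congr (_ * _); rewrite horner_prod.
by apply: eq_bigr => i _; rewrite horner_exp.
Qed.

Lemma mpoly_ring_ind (A : {mpoly k[n]} -> Prop) :
  (forall c, A c%:MP) -> (forall i, A 'X_i) ->
  (forall P Q, A P -> A Q -> A (P + Q)) ->
  (forall P Q, A P -> A Q -> A (P * Q)) -> forall P, A P.
Proof.
move=> AC AX AD AM; elim/mpolyind => [|c m P _ _ IH]; first by rewrite -mpolyC0.
apply: AD => //; rewrite -mul_mpolyC; apply: (AM) => //; rewrite mpolyXE_id.
apply: big_ind; [exact: (AC 1) | exact: AM | move=> i _].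
by elim: (m i) => [|j IHj]; rewrite ?expr0 ?exprS; [exact: (AC 1)| exact: AM].
Qed.

Lemma deriv_arc g P :
  (parc g P)^`() = \sum_i parc g P^`M(i) * (g i)^`().
Proof.
elim/mpoly_ring_ind: P => [c|j|P Q IHP IHQ|P Q IHP IHQ].
- by rewrite arcC derivC big1 // => i _; rewrite mderivC rmorph0 mul0r.
- have U0 : (U_(j) - U_(j) = 0 :> 'X_{1..n})%MM by apply/mnmP => i; rewrite mnmBE subnn mnm0E.
  rewrite arcX (bigD1 j) //= mderivX mnm1E eqxx scale1r U0 mpolyX0 rmorph1 mul1r.
  rewrite big1 ?addr0 // => i ne; rewrite mderivX mnm1E eq_sym (negPf ne) scale0r.
  by rewrite rmorph0 mul0r.
- rewrite rmorphD derivD IHP IHQ -big_split; apply: eq_bigr => i _.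
  by rewrite mderivD rmorphD mulrDl.
rewrite rmorphM derivM IHP IHQ mulr_suml mulr_sumr -big_split.
apply: eq_bigr => i _ /=; rewrite mderivM rmorphD !rmorphM [RHS]mulrDl.
by rewrite [_ * (g i)^`() * _]mulrAC mulrA.
Qed.

Lemma deriv_arc0 g P : ((parc g P)^`()).[0] =
  \sum_i P^`M(i).@[fun i => (g i).[0]] * ((g i)^`()).[0].
Proof.
by rewrite deriv_arc horner_sum; apply: eq_bigr => i _; rewrite hornerM horner_arc.
Qed.

Lemma arc_order d g P : (forall i, exists h, g i = 'X * h) ->
  (forall m, m \in msupp P -> (d <= mdeg m)%N) ->
  exists Q, parc g P = 'X^d * Q.
Proof.
move=> gX Pd.
have mX m : exists Q, mmap1 g m = 'X^(mdeg m) * Q.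
  rewrite mdegE expr_sum /mmap1.
  apply: (big_ind2 (fun a b => exists Q, a = b * Q)) => [|a a' b b' [Q ->] [Q' ->]|i _].
  - by exists 1; rewrite mulr1.
  - by exists (Q * Q'); ring.
  by have [h ->] := gX i; exists (h ^+ m i); rewrite exprMn.
rewrite /= /mmap; elim: (msupp P) Pd => [|m s IH] Pd; first by exists 0; rewrite big_nil mulr0.
have [|Q E] := IH; first by move=> m' sm; apply: Pd; rewrite inE sm orbT.
have [Q' E'] := mX m; exists ((P@_m)%:P * 'X^(mdeg m - d) * Q' + Q).
rewrite big_cons E E' mulrDr; congr (_ + _).
have -> : mdeg m = (d + (mdeg m - d))%N by rewrite subnKC // Pd // inE eqxx.
by rewrite addKn exprD; ring.
Qed.
End Arcs.

Section Closed.
Variable k : closedFieldType.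

(** For p nonzero, p X + 1 is not constant, so it has a root; but it takes the value 1
    everywhere. *)
Lemma poly_horner_eq0 (p : {poly k}) : (forall x, p.[x] = 0) -> p = 0.
Proof.
move=> p0; apply/eqP; apply: contraT => pn0.
have : size (p * 'X + 1%:P) != 1.
  rewrite size_MXaddC (negPf pn0) /=.
  by case: (size p) (size_poly_gt0 p) => [|[]//]; rewrite pn0.
case/closed_rootP => x /rootP; rewrite !hornerE p0 mul0r add0r => /eqP.
by rewrite oner_eq0.
Qed.

Lemma poly_noroot (p : {poly k}) : (forall x, p.[x] != 0) -> exists c, p = c%:P.
Proof.
move=> p0; have : size p == 1.
  apply: contraT => /closed_rootP [x /rootP E]; by move: (p0 x); rewrite E eqxx.
by case/size_poly1P => c _ ->; exists c.
Qed.
End Closed.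

Section ThreeVariables.
Variable k : closedFieldType.
Implicit Types (G : {mpoly k[3]}) (t : k * k * k).

Lemma big_ord3 (T : Type) (idx : T) (op : Monoid.law idx) (F : 'I_3 -> T) :
  \big[op/idx]_i F i = op (op (F 0) (F 1)) (F ord_max).
Proof.
rewrite !big_ord_recr big_ord0 /= Monoid.mul1m.
by congr (op (op (F _) (F _)) (F _)); exact: val_inj.
Qed.

(* Kronecker substitution: base-[b] digits separate the monomials. *)
Lemma mpoly3_eq0 G : (forall t, evm (col3 t) G = 0) -> G = 0.
Proof.
move=> G0; apply/eqP; apply: contraT => nG; pose b := msize G.
pose g : {poly k} * {poly k} * {poly k} := ('X, 'X^b, 'X^(b * b)).
have : parc (comp3 g) G = 0.
  apply: poly_horner_eq0 => x; rewrite horner_arc.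
  rewrite -(G0 (x, x ^+ b, x ^+ (b * b))); apply: meval_eq => i.
  by rewrite mxE; case: (ord3P i) => -> /=; rewrite ?hornerX ?hornerXn.
pose code (m : 'X_{1..3}) := (m ord0 + b * (m 1%R + b * m ord_max))%N.
have gE m : mmap1 (comp3 g) m = 'X^(code m).
  rewrite /mmap1 big_ord3 /= -!exprM -!exprD; congr ('X^_).
  by rewrite /code mulnDr addnA mulnA.
have small m i : m \in msupp G -> (m i < b)%N.
  move/msize_mdeg_lt; apply: leq_ltn_trans; rewrite mdegE (bigD1 i) //=.
  exact: leq_addr.
have inj : {in msupp G &, injective code}.
  move=> m m' sm sm' E.
  have b0 : (0 < b)%N by apply: leq_ltn_trans (small m ord0 sm).
  have mod0 (c d : nat) : (c < b -> (c + b * d) %% b = c)%N.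
    by move=> h; rewrite mulnC addnC modnMDl modn_small.
  have div0 (c d : nat) : (c < b -> (c + b * d) %/ b = d)%N.
    by move=> h; rewrite mulnC addnC divnMDl // divn_small // addn0.
  have E0 : m ord0 = m' ord0.
    by have := congr1 (modn^~ b) E; rewrite /code !mod0 ?small.
  have E1 := congr1 (divn^~ b) E; rewrite /code !div0 ?small // in E1.
  have E2 : m 1 = m' 1 by have := congr1 (modn^~ b) E1; rewrite !mod0 ?small.
  have E3 := addnI (etrans E1 (congr1 (addn^~ _) (esym E2))).
  move/eqP: E3; rewrite eqn_pmul2l // => /eqP E3.
  by apply/mnmP => i; case: (ord3P i) => ->.
have [m sm] : exists m, m \in msupp G.
  by case: (msupp G) (msupp_eq0 G) => [|m s]; [rewrite (negPf nG) | exists m; rewrite mem_head].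
move/(congr1 (fun p : {poly k} => p`_(code m))).
rewrite coef0 /= /mmap coef_sum (bigD1_seq m) ?msupp_uniq //= gE coefCM coefXn eqxx mulr1.
rewrite big_seq_cond big1 => [|m' /andP[sm' ne]].
  by rewrite addr0 => Gm; move: sm; rewrite mcoeff_msupp Gm eqxx.
rewrite gE coefCM coefXn; case: eqP => [E|]; last by rewrite mulr0.
by rewrite (inj _ _ sm sm' E) eqxx in ne.
Qed.

Definition lift t d : {poly k} * {poly k} * {poly k} :=
  (t.1.1%:P + d.1.1%:P * 'X, t.1.2%:P + d.1.2%:P * 'X, t.2%:P + d.2%:P * 'X).

(** On an affine line missing the axis x = y = 0, G has no zero and so is constant. Three such lines
    join a point with x nonzero to (1, 1, 0); hence X_0 (G - c) vanishes everywhere. *)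
Lemma axis_zeros_const G :
  (forall x y z, evm (col3 (x, y, z)) G = 0 -> x = 0 /\ y = 0) ->
  exists2 c, c != 0 & G = c%:MP.
Proof.
move=> Z; pose E x y z := evm (col3 (x, y, z)) G.
have line x y z x' y' z' : (forall c, (x + x' * c != 0) || (y + y' * c != 0)) ->
    E x y z = E (x + x') (y + y') (z + z').
  move=> h; pose g := lift (x, y, z) (x', y', z').
  have gE c : (parc (comp3 g) G).[c] = E (x + x' * c) (y + y' * c) (z + z' * c).
    rewrite horner_arc; apply: meval_eq => i; rewrite mxE.
    by case: (ord3P i) => ->; rewrite /comp3 /= !hornerE.
  have [c|a aE] := @poly_noroot _ (parc (comp3 g) G).
    rewrite gE; apply/eqP => /Z [x0 y0]; move: (h c).
    by rewrite x0 y0 eqxx.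
  have := gE 0; have := gE 1; rewrite aE !hornerC !mulr1 !mulr0 !addr0 => <-.
  by move=> ->.
have add1B (y : k) : y + (1 - y) = 1 by rewrite addrC subrK.
have xE x y z : x != 0 -> E x y z = E 1 1 0.
  move=> x0; have -> : E x y z = E x 1 z.
    have := line x y z 0 (1 - y) 0; rewrite !addr0 add1B; apply => c.
    by rewrite mul0r addr0 x0.
  have -> : E x 1 z = E 1 1 z.
    have := line x 1 z (1 - x) 0 0; rewrite !addr0 add1B; apply => c.
    by rewrite mul0r addr0 oner_eq0 orbT.
  have := line 1 1 z 0 0 (- z); rewrite !addr0 subrr; apply => c.
  by rewrite mul0r addr0 oner_eq0.
exists (E 1 1 0).
  by apply/eqP => /Z [/eqP]; rewrite oner_eq0.
have : (G - (E 1 1 0)%:MP) * 'X_0 = 0.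
  apply: mpoly3_eq0 => -[[x y] z]; rewrite rmorphM rmorphB evmC.
  have -> : evm (col3 (x, y, z)) 'X_0 = x by rewrite [LHS]mevalXU mxE.
  have [->|x0] := eqVneq x 0; first by rewrite mulr0.
  by rewrite -/(E x y z) xE // subrr mul0r.
move/eqP; rewrite mulf_eq0 => /orP[|/eqP X0]; first by rewrite subr_eq0 => /eqP.
have := congr1 (evm (col3 (1, 0, 0))) X0; rewrite rmorph0 [LHS]mevalXU mxE => /eqP.
by rewrite oner_eq0.
Qed.
End ThreeVariables.

Lemma arc_comp n l (k : comNzRingType) (T : n.-tuple {mpoly k[l]}) (h : 'I_l -> {poly k})
  (P : {mpoly k[n]}) : parc h (P \mPo T) = parc (fun i => parc h (tnth T i)) P.
Proof.
elim/mpoly_ring_ind: P => [c|i|P Q IHP IHQ|P Q IHP IHQ].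
- by rewrite comp_mpolyC !arcC.
- by rewrite comp_mpolyXU arcX -tnth_nth.
- by rewrite comp_mpolyD !rmorphD IHP IHQ.
have -> : (P * Q) \mPo T = (P \mPo T) * (Q \mPo T) by exact: rmorphM.
by rewrite !rmorphM IHP IHQ.
Qed.

(** * Smoothness off the node, and irreducibility *)

Section Smooth.
Variables (k : closedFieldType) (e : k).
Hypothesis e0 : e != 0.

Lemma arc_octic (g : {poly k} * {poly k} * {poly k}) :
  parc (comp3 g) (octic e) = oct e%:P g.
Proof.
rewrite -oct_map arcC; congr (oct _ _).
by case: g => [[x y] z]; congr (_, _, _); rewrite arcX.
Qed.

Definition at0 : {rmorphism {poly k} -> k} := horner_eval 0.

(* Along an arc [u] crossing the line transversally, [oct (phi u)] is a unit
   times [lin u], hence has a simple zero. *)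
Lemma grad_octic_neq0 v : oct e (tr v) = 0 -> cub e (tr v) != 0 ->
  exists i, (octic e)^`M(i).@[fun j => v j 0] != 0.
Proof.
move=> g0 f0; apply/existsP; apply: contraT; rewrite negb_exists => /forallP D0.
pose s := e ^+ 3 * cub e (tr v) ^+ 21.
have s0 : s != 0 by rewrite mulf_neq0 ?expf_neq0.
pose w := phi e (tr v).
pose u : {poly k} * {poly k} * {poly k} := (w.1.1%:P, w.1.2%:P, w.2%:P + 'X).
(* As [phi (phi v)] is s v, this scaling makes the arc start at v itself. *)
pose g := scal (s^-1)%:P (phi e%:P u).
have eC (c : k) : at0 c%:P = c by exact: hornerC.
have u0 : map3 at0 u = w.
  have X0 : at0 'X = 0 by exact: hornerX.
  rewrite /map3 [at0 u.2]rmorphD X0 addr0 !eC.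
  by case: w {u g} => [[x y] z].
have gv : map3 at0 g = tr v.
  rewrite /g -scal_map -phi_map !eC u0 phi_phi scalA mulVf //.
  by rewrite /scal; case: (tr v) => [[x y] z]; rewrite !mul1r.
have linu : lin e%:P u = 'X.
  have -> : lin e%:P u = (lin e w)%:P + 'X.
    rewrite /lin /u; case: w {u u0 g gv} => [[x y] z] /=.
    by rewrite !(rmorphD, rmorphM, rmorph1, rmorph_nat); ring.
  by rewrite -[lin e w]/(oct e (tr v)) g0 add0r.
have := deriv_arc0 (comp3 g) (octic e).
rewrite big1 => [|i _]; last first.
  rewrite (meval_eq (v2 := fun j => v j 0)); last first.
    move=> j; have -> : v j 0 = comp3 (tr v) j.
      by rewrite -{1}(col3_tr v) mxE.
    by rewrite -gv; case: (ord3P j) => ->.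
  by have := D0 i; rewrite negbK => /eqP ->; rewrite mul0r.
rewrite arc_octic oct_scal oct_phi linu mulrA derivM derivX mulr1 hornerD hornerM hornerX.
rewrite mulr0 add0r => /eqP.
have -> : ((s^-1)%:P ^+ 8 * (e%:P ^+ 3 * cub e%:P u ^+ 21)).[0]
  = (s^-1) ^+ 8 * (e ^+ 3 * (e * cub e (tr v) ^+ 8) ^+ 21).
  rewrite -[LHS]/(at0 _) !(rmorphM, rmorphXn) !eC -cub_map eC u0.
  by rewrite cubphi.
apply: contraTT => _; apply: mulf_neq0; first by apply: expf_neq0; rewrite invr_eq0.
by apply: mulf_neq0; apply: expf_neq0 => //; apply: mulf_neq0 => //; apply: expf_neq0.
Qed.

(** Multiplicity at least 2 kills the derivatives along the first two columns of B, and homogeneity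
    the one along the third column q. As B is invertible the gradient would vanish. *)
Lemma octic_smooth (q : 'cV[k]_3) (B : 'M[k]_3) m : ev (octic e) q = 0 ->
  cub e (tr q) != 0 -> B \in unitmx -> col ord_max B = q ->
  mult0 (affine_chart (octic e) B) m -> (m <= 1)%N.
Proof.
rewrite ev_octic => g0 f0 uB Bq [_ [m2 _]]; rewrite leqNgt; apply/negP => m1.
have [i /eqP] := grad_octic_neq0 g0 f0; apply.
pose D := \row_i (octic e)^`M(i).@[fun j => q j 0].
suff : D *m B = 0.
  move=> DB; have : D = 0 by rewrite -[D](mulmxK uB) DB mul0mx.
  by move/rowP/(_ i); rewrite !mxE.
have dir (a b : k) : \sum_i D 0 i * (B i 0 * a + B i 1 * b) = 0.
  pose h (i : 'I_2) : {poly k} := (if i == 0 then a else b) *: 'X.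
  have [|Q EQ] := @arc_order _ _ m h (affine_chart (octic e) B) _ m2.
    by move=> j; exists (if j == 0 then a else b)%:P; rewrite /h -mul_polyC mulrC.
  have {EQ}[Q' EQ] : exists Q', parc h (affine_chart (octic e) B) = 'X * ('X * Q').
    exists ('X^(m - 2) * Q); rewrite EQ -{1}(subnK m1) exprD expr2.
    by move: ('X^_) => y; ring.
  have := deriv_arc0 (fun i => parc h (tnth (chart_subst B) i)) (octic e).
  rewrite -arc_comp -/(affine_chart (octic e) B) EQ derivM derivX hornerD !hornerM.
  rewrite hornerX !mul0r mulr0 addr0 => E; rewrite [RHS]E.
  have hE j : parc h (tnth (chart_subst B) j)
     = (B j 0 * a + B j 1 * b) *: 'X + (B j ord_max)%:P.
    rewrite tnth_mktuple -!mul_mpolyC !(rmorphD, rmorphM) !arcC !arcX /h /=.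
    by rewrite -!mul_polyC !(rmorphD, rmorphM); ring.
  apply: eq_bigr => j _; rewrite mxE hE derivD derivZ derivX derivC addr0 hornerZ hornerC mulr1.
  congr (_ * _); apply: meval_eq => l; rewrite hE hornerD hornerZ hornerX hornerC mulr0 add0r.
  by rewrite -Bq mxE.
(* Differentiate along the ray (1 + t) q, on which the octic is identically zero. *)
have euler : \sum_i D 0 i * q i 0 = 0.
  pose g := scal (1 + 'X) (map3 polyC (tr q)).
  have := deriv_arc0 (comp3 g) (octic e).
  rewrite arc_octic oct_scal oct_map g0 rmorph0 mulr0 derivC horner0 => E; rewrite [RHS]E.
  have gE j : comp3 g j = (q j 0)%:P * (1 + 'X).
    by rewrite /g /scal; case: (ord3P j) => ->; rewrite /comp3 /= mulrC.
  apply: eq_bigr => j _; rewrite mxE gE derivM derivC mul0r add0r derivD derivX derivC add0r.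
  rewrite mulr1 hornerC; congr (_ * _); apply: meval_eq => l.
  by rewrite gE !hornerE.
apply/rowP => j; rewrite !mxE; case: (ord3P j) => ->.
- by rewrite -[RHS](dir 1 0); apply: eq_bigr => l _; rewrite mulr0 addr0 mulr1.
- by rewrite -[RHS](dir 0 1); apply: eq_bigr => l _; rewrite mulr0 add0r mulr1.
by rewrite -[RHS]euler; apply: eq_bigr => l _; congr (_ * _); rewrite -Bq mxE.
Qed.

(* A zero of [G] off the cubic would be a common zero of [G] and [H], that is, a
   singular point of the octic; so [G] vanishes at most on the axis over the
   singular point. *)
Lemma octic_factor_unit G H : octic e = G * H ->
  (forall t, lin e t = 0 -> evm (col3 (phi e t)) H = 0) -> G \is a GRing.unit.
Proof.
move=> GH H0; suff [c c0 ->] : exists2 c, c != 0 & G = c%:MP.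
  apply/unitrP; exists (c^-1)%:MP.
  by rewrite -!mpolyCM mulVf // mulfV.
apply: axis_zeros_const => x y z G0; set v := col3 (x, y, z).
have tv : tr v = (x, y, z) by rewrite tr_col3.
have g0 : oct e (x, y, z) = 0 by rewrite -tv -evm_octic GH rmorphM G0 mul0r.
have [f0|f0] := eqVneq (cub e (x, y, z)) 0; first exact: cub_oct_eq0 f0 g0.
have s0 : e ^+ 3 * cub e (x, y, z) ^+ 21 != 0 by rewrite mulf_neq0 ?expf_neq0.
(* H is not known to be homogeneous, so a multiple of [phi v] is chosen whose image by phi is
   exactly v; this takes an 8th root. *)
have [c cE] : exists c : k, c ^+ 8 = (e ^+ 3 * cub e (x, y, z) ^+ 21)^-1.
  have : size ('X^8 - (e ^+ 3 * cub e (x, y, z) ^+ 21)^-1%:P) != 1.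
    by rewrite size_XnsubC.
  case/closed_rootP => c /rootP; rewrite !hornerE => /eqP; rewrite subr_eq0 => /eqP cE.
  by exists c.
have Hv : evm v H = 0.
  have := H0 (scal c (phi e (x, y, z))); rewrite lin_scal -/(oct e (x, y, z)) g0 mulr0.
  rewrite phi_scal phi_phi scalA cE mulVf //.
  have -> : scal 1 (x, y, z) = (x, y, z) by rewrite /scal !mul1r.
  by apply.
rewrite -tv in f0 g0; have [i /eqP[]] := grad_octic_neq0 g0 f0.
rewrite GH mderivM mevalD !mevalM.
by rewrite -[G.@[_]]/(evm v G) -[H.@[_]]/(evm v H) G0 Hv mulr0 mul0r addr0.
Qed.

(** Phi restricted to the line pulls the octic back to 0 in the domain k[X_0, X_1]. One factor is
    therefore pulled back to 0, and [octic_factor_unit] applies to the other. *)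
Lemma octic_irreducible : mirreducible (octic e).
Proof.
split=> [|G H GH].
  apply/unitrP => -[P [/(congr1 (evm 0)) + _]].
  rewrite rmorphM rmorph1 evm_octic /tr !mxE oct000 mulr0 => /eqP.
  by rewrite eq_sym oner_eq0.
pose y : {mpoly k[2]} * {mpoly k[2]} * {mpoly k[2]} :=
  ('X_0, 'X_1, - (1 + 2 * e%:MP) * 'X_1 - (2 + e%:MP) * 'X_0).
pose h : {rmorphism {mpoly k[3]} -> {mpoly k[2]}} := mmap (@mpolyC 2 k) (comp3 (phi e%:MP y)).
have hC c : h c%:MP = c%:MP by exact: mmapC.
have hX : map3 h (X3 k) = phi e%:MP y.
  by congr (_, _, _); rewrite [LHS]mmapX mmap1U.
have liny : lin e%:MP y = 0 by rewrite /lin /y; ring.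
have : h (octic e) = 0 by rewrite -oct_map hC hX oct_phi liny mulr0.
have hev P t : lin e t = 0 -> h P = 0 -> evm (col3 (phi e t)) P = 0.
  case: t => [[a b] c] lt hP.
  pose ab (i : 'I_2) := if i == 0 then a else b.
  pose r : {rmorphism {mpoly k[2]} -> k} := meval ab.
  have rC d : r d%:MP = d by exact: mevalC.
  have ry : map3 r y = (a, b, c).
    have := congr1 r liny; rewrite -lin_map rC rmorph0 /map3.
    have -> : r y.1.1 = a by exact: mevalXU.
    have -> : r y.1.2 = b by exact: mevalXU.
    by rewrite -lt /lin => /addIr/addIr ->.
  have rhP : evm (col3 (phi e (a, b, c))) P = r (h P).
    have E : map3 r (phi e%:MP y) = phi e (a, b, c) by rewrite -phi_map rC ry.
    rewrite -E {hP}; elim/mpoly_ring_ind: P => [d|i|P Q IHP IHQ|P Q IHP IHQ].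
    - by rewrite evmC hC rC.
    - rewrite [LHS]mevalXU mxE [X in r X]mmapX mmap1U.
      by case: (ord3P i) => ->.
    - by rewrite !rmorphD IHP IHQ.
    by rewrite !rmorphM IHP IHQ.
  by rewrite rhP hP rmorph0.
rewrite GH rmorphM => /eqP; rewrite mulf_eq0 => /orP[/eqP h0|/eqP h0].
  right; apply: (@octic_factor_unit H G); first by rewrite GH mulrC.
  by move=> t lt; apply: hev.
by left; apply: (@octic_factor_unit G H) => // t lt; apply: hev.
Qed.

Lemma octic_irreducible_curve : irreducible_plane_curve 8 (octic e).
Proof.
split; first exact: homog_oct; split; last exact: octic_irreducible.
apply/eqP => E; have [_ irr] := octic_irreducible.
by have [] := irr 0 0 (etrans E (esym (mulr0 0))); rewrite unitr0.
Qed.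
End Smooth.

(** * The tower of triple points *)

Section Tower.
Variable R : comNzRingType.
Implicit Types (e x v t y s w : R).

(** The quotients of [cub], [z1_], [x3_] by x^2, x, x^2 in the chart y = x v, with z = 1; [blow1]
    assembles [oct] from them. The families [b2*] and [b5*] play the same part further up the
    tower. *)
Definition b1f e x v := v - x - e * x * v ^+ 3.
Definition b1w e x v := v - x - e * x ^+ 2 * v ^+ 2.
Definition b1q e x v := (v - x) * b1w e x v - e * x ^+ 2 * b1f e x v * v ^+ 2.
Definition blow1 e x v :=
  (v - x) * b1w e x v ^+ 2 - 2 * e * x ^+ 2 * b1w e x v * b1f e x v * v ^+ 2
  + e * x ^+ 3 * b1f e x v ^+ 2 * v
  + (1 + 2 * e) * (x ^+ 2 * (v - x) * b1f e x v ^+ 2)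
  + (2 + e) * (x * b1q e x v * b1f e x v).

(** Three successive points share this shape: t is a power of x, and y is the plane coordinate y
    divided by x^2. *)
Definition b2f e t y v := v - e * t * y ^+ 3.
Definition b2w e t y v := v - e * t * y ^+ 2.
Definition b2q e t y v := v * b2w e t y v - e * t * b2f e t y v * y ^+ 2.
Definition blow2 e t x y v :=
  v * b2w e t y v ^+ 2 - 2 * e * t * b2w e t y v * b2f e t y v * y ^+ 2
  + e * t * b2f e t y v ^+ 2 * y
  + (1 + 2 * e) * (x ^+ 2 * v * b2f e t y v ^+ 2)
  + (2 + e) * (x * b2q e t y v * b2f e t y v).

(** After the shear by e, the y of [blow2] is 1 + s w with s = x^3. The brackets here and in [b5w]
    are (1 + s w)^3 - 1 and (1 + s w)^2 - 1 divided by s w. *)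
Definition b5f e s t w v := v - e * t * w * (3 + 3 * s * w + s ^+ 2 * w ^+ 2).
Definition b5w e s t w v := v - e * t * w * (2 + s * w).
Definition b5q e s t r w v :=
  v * b5w e s t w v + e ^+ 2 * (1 + s * w) ^+ 2 * w * r
  - e * b5f e s t w v * t * w * (2 + s * w).
Definition blow5 e s t r u x w v :=
  v * b5w e s t w v ^+ 2 + e ^+ 3 * (1 + s * w) ^+ 4 * t * r * w ^+ 2
  - 2 * e * b5w e s t w v * b5f e s t w v * t * w * (2 + s * w)
  + e * b5f e s t w v ^+ 2 * t * w
  + (1 + 2 * e) * (u * w * b5f e s t w v ^+ 2)
  + (2 + e) * (x * b5q e s t r w v * b5f e s t w v).

(* Local equation at the (i+1)-st point; there the plane coordinates are
   (x, y) with y = v, xv, x^2(1+v), x^2(1+xv), x^2(1+x^2v), x^2+x^5(e+v),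
   x^2+x^5(e+xv) for i = 0, ..., 6. *)
Definition tower e (i : nat) x v : R :=
  match i with
  | 0 => oct e (x, v, 1)
  | 1 => blow1 e x v
  | 2 => blow2 e (x ^+ 3) x (1 + v) v
  | 3 => blow2 e (x ^+ 2) x (1 + x * v) v
  | 4 => blow2 e x x (1 + x ^+ 2 * v) v
  | 5 => blow5 e (x ^+ 3) (x ^+ 3) (x ^+ 3) (x ^+ 2) x (e + v) v
  | _ => blow5 e (x ^+ 3) (x ^+ 2) x x x (e + x * v) v
  end.

(** The followed branch of the cubic is y = x^2 + e x^5 + ...; its two coefficients enter when the
    exponents 2 and 5 are reached. *)
Definition shear e (i : nat) : R := match i with 1 => 1 | 4 => e | _ => 0 end.

Lemma tower_step e i x v : (i < 6)%N ->
  tower e i x (shear e i * x + x * v) = x ^+ 3 * tower e i.+1 x v.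
Proof.
case: i => [|[|[|[|[|[|//]]]]]] _; rewrite /tower /shear.
- have -> : oct e (x, 0 * x + x * v, 1) = oct e (x, x * v, 1) by rewrite mul0r add0r.
  rewrite /blow1 /b1q octE /z2_ /x3_.
  have -> : cub e (x, x * v, 1) = x ^+ 2 * b1f e x v by rewrite /cub /b1f; ring.
  have -> : x2_ (x, x * v, 1) = x * (v - x) by rewrite /x2_; ring.
  have -> : z1_ e (x, x * v, 1) = x * b1w e x v by rewrite /z1_ /b1w; ring.
  by move: (b1f e x v) (b1w e x v) => f w; ring.
- rewrite /blow1 /blow2 /b1q /b2q.
  have -> : b1f e x (1 * x + x * v) = x * b2f e (x ^+ 3) (1 + v) v
    by rewrite /b1f /b2f; ring.
  have -> : b1w e x (1 * x + x * v) = x * b2w e (x ^+ 3) (1 + v) v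
    by rewrite /b1w /b2w; ring.
  by move: (b2f _ _ _ _) (b2w _ _ _ _) => f w; ring.
- rewrite /blow2 /b2q.
  have -> : b2f e (x ^+ 3) (1 + (0 * x + x * v)) (0 * x + x * v)
    = x * b2f e (x ^+ 2) (1 + x * v) v by rewrite /b2f; ring.
  have -> : b2w e (x ^+ 3) (1 + (0 * x + x * v)) (0 * x + x * v)
    = x * b2w e (x ^+ 2) (1 + x * v) v by rewrite /b2w; ring.
  by move: (b2f _ _ _ _) (b2w _ _ _ _) => f w; ring.
- rewrite /blow2 /b2q.
  have -> : b2f e (x ^+ 2) (1 + x * (0 * x + x * v)) (0 * x + x * v)
    = x * b2f e x (1 + x ^+ 2 * v) v by rewrite /b2f; ring.
  have -> : b2w e (x ^+ 2) (1 + x * (0 * x + x * v)) (0 * x + x * v)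
    = x * b2w e x (1 + x ^+ 2 * v) v by rewrite /b2w; ring.
  by move: (b2f _ _ _ _) (b2w _ _ _ _) => f w; ring.
- rewrite /blow2 /b2q /blow5 /b5q.
  have -> : b2f e x (1 + x ^+ 2 * (e * x + x * v)) (e * x + x * v)
    = x * b5f e (x ^+ 3) (x ^+ 3) (e + v) v by rewrite /b2f /b5f; ring.
  have -> : b2w e x (1 + x ^+ 2 * (e * x + x * v)) (e * x + x * v)
    = x * b5w e (x ^+ 3) (x ^+ 3) (e + v) v by rewrite /b2w /b5w; ring.
  set f := b5f _ _ _ _ _; set w := b5w _ _ _ _ _.
  (* Only at this step is the division by x^3 not term by term: terms of order 2 cancel through this
     relation, leaving [blow5], all of whose summands visibly have order at least 3. *)
  have fw : w = f + e * (x ^+ 3 * (e + v)) * (1 + x ^+ 3 * (e + v)) ^+ 2.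
    by rewrite /w /f /b5w /b5f; ring.
  by rewrite fw; move: f {fw w} => f; ring.
rewrite /blow5 /b5q.
have -> : b5f e (x ^+ 3) (x ^+ 3) (e + (0 * x + x * v)) (0 * x + x * v)
  = x * b5f e (x ^+ 3) (x ^+ 2) (e + x * v) v by rewrite /b5f; ring.
have -> : b5w e (x ^+ 3) (x ^+ 3) (e + (0 * x + x * v)) (0 * x + x * v)
  = x * b5w e (x ^+ 3) (x ^+ 2) (e + x * v) v by rewrite /b5w; ring.
by move: (b5f _ _ _ _ _) (b5w _ _ _ _ _) => f w; ring.
Qed.

(** Restriction to x = 0 bounds the multiplicity by 3 from above; [ordge_tower] gives the lower
    bound. *)
Lemma tower_x0 e i v : (i < 7)%N ->
  exists c, tower e i 0 v = v ^+ 3 * (1 + v * c).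
Proof.
case: i => [|i] i7.
  exists (- (2 + e) * e * v + 2 * e ^+ 2 * v ^+ 2 + (1 + 2 * e) * e ^+ 2 * v ^+ 3
    - (2 + e) * e ^+ 3 * v ^+ 4); rewrite /tower octE /z2_ /x3_.
  have -> : cub e (0, v, 1) = - e * v ^+ 3 by rewrite /cub; ring.
  have -> : x2_ (0, v, 1) = v by rewrite /x2_; ring.
  have -> : z1_ e (0, v, 1) = v by rewrite /z1_; ring.
  by ring.
exists 0; case: i i7 => [|[|[|[|[|[|//]]]]]] _; rewrite /tower.
- by rewrite /blow1 /b1q /b1f /b1w; ring.
- by rewrite /blow2 /b2q /b2f /b2w; ring.
- by rewrite /blow2 /b2q /b2f /b2w; ring.
- by rewrite /blow2 /b2q /b2f /b2w; ring.
- by rewrite /blow5 /b5q /b5f /b5w; ring.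
by rewrite /blow5 /b5q /b5f /b5w; ring.
Qed.

(* [lead e 0 a b] is the tangent cone [(b + e^2 a)^2 (b + e a)] of the last local
   equation; its linear term in [x] decides smoothness on the exceptional
   curve. *)
Definition leadw e x a b := e + x ^+ 2 * a * b.
Definition leadf e x a b := b - e * x * a ^+ 2 * leadw e x a b *
  (3 + 3 * (x * a) ^+ 3 * leadw e x a b + ((x * a) ^+ 3) ^+ 2 * leadw e x a b ^+ 2).
Definition leadg e x a b :=
  b - e * x * a ^+ 2 * leadw e x a b * (2 + (x * a) ^+ 3 * leadw e x a b).
Definition leadq e x a b :=
  x * b * leadg e x a b + e ^+ 2 * (1 + (x * a) ^+ 3 * leadw e x a b) ^+ 2 * leadw e x a b * a
  - e * leadf e x a b * x ^+ 2 * a ^+ 2 * leadw e x a b * (2 + (x * a) ^+ 3 * leadw e x a b).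
Definition lead e x a b :=
  b * leadg e x a b ^+ 2
  + e ^+ 3 * a ^+ 3 * (1 + (x * a) ^+ 3 * leadw e x a b) ^+ 4 * leadw e x a b ^+ 2
  - 2 * e * x * leadg e x a b * leadf e x a b * a ^+ 2 * leadw e x a b *
     (2 + (x * a) ^+ 3 * leadw e x a b)
  + e * x * leadf e x a b ^+ 2 * a ^+ 2 * leadw e x a b
  + (1 + 2 * e) * (a * leadw e x a b * leadf e x a b ^+ 2)
  + (2 + e) * (a * leadq e x a b * leadf e x a b).

Lemma tower6_lead e x a b : tower e 6 (x * a) (x * b) = x ^+ 3 * lead e x a b.
Proof.
rewrite /tower /blow5 /lead /b5q /leadq.
have -> : e + x * a * (x * b) = leadw e x a b by rewrite /leadw; ring.
have -> : b5f e ((x * a) ^+ 3) ((x * a) ^+ 2) (leadw e x a b) (x * b) = x * leadf e x a b.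
  by rewrite /leadf /b5f; move: (leadw e x a b) => w; ring.
have -> : b5w e ((x * a) ^+ 3) ((x * a) ^+ 2) (leadw e x a b) (x * b) = x * leadg e x a b.
  by rewrite /leadg /b5w; move: (leadw e x a b) => w; ring.
by move: (leadw e x a b) (leadf e x a b) (leadg e x a b) => w f g; ring.
Qed.
End Tower.

Lemma tower_map (R S : comNzRingType) (h : {rmorphism R -> S}) e i x v :
  h (tower e i x v) = tower (h e) i (h x) (h v).
Proof.
case: i => [|i]; first by rewrite /= -oct_map /map3 /= rmorph1.
case: i => [|[|[|[|[|i]]]]]; rewrite /tower.
- by rewrite /blow1 /b1q /b1f /b1w !(rmorphE, rmorphM).
- by rewrite /blow2 /b2q /b2f /b2w !(rmorphE, rmorphM).
- by rewrite /blow2 /b2q /b2f /b2w !(rmorphE, rmorphM).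
- by rewrite /blow2 /b2q /b2f /b2w !(rmorphE, rmorphM).
- by rewrite /blow5 /b5q /b5f /b5w !(rmorphE, rmorphM).
by rewrite /blow5 /b5q /b5f /b5w !(rmorphE, rmorphM).
Qed.

Section Order.
Variables (n : nat) (k : idomainType).
Implicit Types g h : {mpoly k[n]}.

Definition ordge (d : nat) g := forall m, m \in msupp g -> (d <= mdeg m)%N.

Lemma ordgeD d g h : ordge d g -> ordge d h -> ordge d (g + h).
Proof.
move=> dg dh m /msuppD_le; rewrite mem_cat => /orP[]; [exact: dg | exact: dh].
Qed.
Lemma ordgeN d g : ordge d g -> ordge d (- g).
Proof. by move=> dg m; rewrite (perm_mem (msuppN g)); exact: dg. Qed.
Lemma ordgeB d g h : ordge d g -> ordge d h -> ordge d (g - h).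
Proof. by move=> dg /ordgeN; exact: ordgeD. Qed.
Lemma ordgeM a b g h : ordge a g -> ordge b h -> ordge (a + b) (g * h).
Proof.
move=> ag bh m /msuppM_le /allpairsP [[m1 m2] /= [s1 s2 ->]].
by rewrite mdegD leq_add ?ag ?bh.
Qed.
Lemma ordge0 g : ordge 0 g. Proof. by []. Qed.
Lemma ordgeMl d g h : ordge d g -> ordge d (h * g).
Proof. by move=> dg; exact: (@ordgeM 0 d h g (@ordge0 h) dg). Qed.
Lemma ordgeMr d g h : ordge d g -> ordge d (g * h).
Proof. by move=> dg; rewrite mulrC; exact: ordgeMl. Qed.
Lemma ordgeW a d g : (a <= d)%N -> ordge d g -> ordge a g.
Proof. by move=> ad dg m /dg; exact: leq_trans. Qed.
Lemma ordgeX d a g : ordge d g -> ordge (a * d) (g ^+ a).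
Proof.
by move=> dg; elim: a => [|a IH]; rewrite ?expr0 // exprS mulSn; exact: ordgeM.
Qed.
Lemma ordgeU i : ordge 1 'X_i.
Proof. by move=> m; rewrite msuppX inE => /eqP ->; rewrite mdeg1. Qed.
End Order.

Section TowerOrder.
Variables (k : closedFieldType) (e : k).
Local Notation E := (e%:MP_[2] : {mpoly k[2]}).
Local Notation X := ('X_0 : {mpoly k[2]}).
Local Notation V := ('X_1 : {mpoly k[2]}).

Let oX : ordge 1 X := @ordgeU 2 k 0.
Let oV : ordge 1 V := @ordgeU 2 k 1.

(** No expansion: every summand contains three factors vanishing at the origin, counted with
    multiplicity. *)
Lemma ordge_blow2 t y : ordge 1 t -> ordge 3 (blow2 E t X y V).
Proof.
move=> ot.
have of1 : ordge 1 (b2f E t y V).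
  by apply: ordgeB => //; apply: ordgeMr; exact: ordgeMl.
have og : ordge 1 (b2w E t y V).
  by apply: ordgeB => //; apply: ordgeMr; exact: ordgeMl.
have oq : ordge 1 (b2q E t y V).
  apply: ordgeB; first exact: ordgeMr.
  by apply: ordgeMr; apply: ordgeMr; exact: ordgeMl.
have o2 := @ordgeM _ _ 1 1; have o3 := @ordgeM _ _ 2 1; have o3' := @ordgeM _ _ 1 2.
have s2 g : ordge 1 g -> ordge 2 (g ^+ 2) by move=> /(@ordgeX _ _ _ 2).
rewrite /blow2; apply: ordgeD; [apply: ordgeD; [apply: ordgeD; [apply: ordgeB|]|]|].
- by apply: o3' => //; apply: s2.
- by apply: ordgeMr; apply: o3 => //; apply: o2 => //; exact: ordgeMl.
- by apply: ordgeMr; apply: o3'; [exact: ordgeMl | exact: s2].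
- by apply: ordgeMl; apply: o3'; [apply: ordgeMl | exact: s2].
- by apply: ordgeMl; apply: o3 => //; apply: o2.
Qed.

Lemma ordge_blow5 s t r u w : ordge 2 t -> ordge 1 r -> ordge 1 u ->
  ordge 3 (blow5 E s t r u X w V).
Proof.
move=> ot or ou.
have ot1 : ordge 1 t by exact: ordgeW ot.
have of1 : ordge 1 (b5f E s t w V).
  by apply: ordgeB => //; apply: ordgeMr; apply: ordgeMr; exact: ordgeMl.
have og : ordge 1 (b5w E s t w V).
  by apply: ordgeB => //; apply: ordgeMr; apply: ordgeMr; exact: ordgeMl.
have oq : ordge 1 (b5q E s t r w V).
  apply: ordgeB; first by apply: ordgeD; [exact: ordgeMr | exact: ordgeMl].
  by apply: ordgeMr; apply: ordgeMr; exact: ordgeMl.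
have o2 := @ordgeM _ _ 1 1; have o3 := @ordgeM _ _ 2 1; have o3' := @ordgeM _ _ 1 2.
have s2 g : ordge 1 g -> ordge 2 (g ^+ 2) by move=> /(@ordgeX _ _ _ 2).
rewrite /blow5; apply: ordgeD; [apply: ordgeD; [apply: ordgeD; [apply: ordgeB; [apply: ordgeD|]|]|]|].
- by apply: o3' => //; apply: s2.
- by apply: ordgeMr; apply: o3 => //; exact: ordgeMl.
- apply: ordgeMr; apply: ordgeMr; apply: o3' => //; exact: ordgeMl.
- apply: ordgeMr; apply: o3 => //; apply: ordgeMl; exact: s2.
- by apply: ordgeMl; apply: o3'; [apply: ordgeMr | exact: s2].
- by apply: ordgeMl; apply: o3 => //; apply: o2.
Qed.

Lemma ordge_tower i : (i < 7)%N -> ordge 3 (tower E i X V).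
Proof.
have o2 := @ordgeM 2 k 1 1; have o3 := @ordgeM 2 k 2 1; have o3' := @ordgeM 2 k 1 2.
have s2 g : ordge 1 g -> ordge 2 (g ^+ 2 : {mpoly k[2]}) by move=> /(@ordgeX _ _ _ 2).
have s3 g : ordge 1 g -> ordge 3 (g ^+ 3 : {mpoly k[2]}) by move=> /(@ordgeX _ _ _ 3).
case: i => [|[|[|[|[|[|[|//]]]]]]] _; rewrite /tower.
- have of2 : ordge 2 (cub E (X, V, 1)).
    rewrite /cub; apply: ordgeB; last by apply: ordgeMl; apply: ordgeW (s3 _ oV).
    by apply: ordgeB; [apply: ordgeMr; exact: o2 | apply: ordgeW (s3 _ oX)].
  have of1 : ordge 1 (cub E (X, V, 1)) by exact: ordgeW of2.
  have op : ordge 1 (x2_ (X, V, 1)).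
    by rewrite /x2_; apply: ordgeB; [exact: ordgeMr | apply: ordgeW (s2 _ oX)].
  have ow : ordge 1 (z1_ E (X, V, 1)).
    rewrite /z1_; apply: ordgeB; last by apply: ordgeMr; exact: ordgeMl.
    by apply: ordgeB; [exact: ordgeMr | apply: ordgeMr; apply: ordgeW (s2 _ oX)].
  have oq : ordge 1 (x3_ E (X, V, 1)).
    rewrite /x3_; apply: ordgeB; first exact: ordgeMr.
    by apply: ordgeMr; exact: ordgeMl.
  rewrite octE; apply: ordgeD; [apply: ordgeD|].
  + rewrite /z2_; apply: ordgeD; [apply: ordgeB|].
    * by apply: o3' => //; exact: s2.
    * by apply: ordgeMr; apply: o3' => //; apply: ordgeMl.
    * by apply: ordgeMr; apply: o3 => //; apply: ordgeMl; exact: s2.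
  + by apply: ordgeMl; apply: o3' => //; exact: s2.
  + by apply: ordgeMl; apply: o3'.
- have of1 : ordge 1 (b1f E X V).
    rewrite /b1f; apply: ordgeB; first exact: ordgeB.
    by apply: ordgeMr; exact: ordgeMl.
  have og : ordge 1 (b1w E X V).
    rewrite /b1w; apply: ordgeB; first exact: ordgeB.
    by apply: ordgeMl; apply: ordgeW (s2 _ oV).
  have ovx : ordge 1 (V - X) by exact: ordgeB.
  have oq : ordge 1 (b1q E X V).
    rewrite /b1q; apply: ordgeB; first exact: ordgeMr.
    by apply: ordgeMr; exact: ordgeMl.
  rewrite /blow1; apply: ordgeD; [apply: ordgeD; [apply: ordgeD; [apply: ordgeB|]|]|].
  + by apply: o3' => //; exact: s2.
  + by apply: o3'; [exact: ordgeMl | exact: s2].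
  + by apply: ordgeMr; apply: ordgeMr; apply: ordgeMl; exact: s3.
  + by apply: ordgeMl; apply: ordgeMr; apply: o3 => //; exact: s2.
  + by apply: ordgeMl; apply: o3 => //; apply: o2.
- by apply: ordge_blow2; apply: ordgeW (s3 _ oX).
- by apply: ordge_blow2; apply: ordgeW (s2 _ oX).
- exact: ordge_blow2.
- apply: ordge_blow5; [apply: ordgeW (s3 _ oX) | apply: ordgeW (s3 _ oX) | apply: ordgeW (s2 _ oX)] => //.
- by apply: ordge_blow5 => //; apply: s2.
Qed.
End TowerOrder.

Section Jets.
Variable R : comNzRingType.
Implicit Types p q : {poly R}.

Definition jet p : R * R := (p.[0], (p^`()).[0]).

Lemma jetD p q a a' b b' : jet p = (a, a') -> jet q = (b, b') ->
  jet (p + q) = (a + b, a' + b').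
Proof. by move=> [<- <-] [<- <-]; rewrite /jet derivD !hornerD. Qed.
Lemma jetB p q a a' b b' : jet p = (a, a') -> jet q = (b, b') ->
  jet (p - q) = (a - b, a' - b').
Proof. by move=> [<- <-] [<- <-]; rewrite /jet derivB !hornerD !hornerN. Qed.
Lemma jetC c : jet c%:P = (c, 0).
Proof. by rewrite /jet derivC !hornerC. Qed.
Lemma jetX : jet 'X = (0, 1).
Proof. by rewrite /jet derivX hornerX hornerC. Qed.
Lemma jet1 : jet 1 = (1, 0). Proof. exact: jetC. Qed.
Lemma jet_nat n : jet n%:R = (n%:R, 0).
Proof. by rewrite -polyC_natr jetC. Qed.
End Jets.

Lemma jetM (R : comNzRingType) (p q : {poly R}) a a' b b' :
  jet p = (a, a') -> jet q = (b, b') -> jet (p * q) = (a * b, a' * b + a * b').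
Proof. by move=> [<- <-] [<- <-]; rewrite /jet derivM hornerD !hornerM. Qed.
Lemma jet_exp (R : comNzRingType) (p : {poly R}) n a a' : jet p = (a, a') ->
  jet (p ^+ n.+1) = (a ^+ n.+1, a' * a ^+ n *+ n.+1).
Proof.
by move=> [<- <-]; rewrite /jet deriv_exp hornerMn !hornerM !horner_exp.
Qed.

(** Computes a jet by recursion on the syntax of the polynomial, filling an existential variable;
    the result is then normalized by [ring]. *)
Ltac jets := first
  [ eassumption
  | apply: jetD; [jets | jets]
  | apply: jetB; [jets | jets]
  | apply: jetM; [jets | jets]
  | apply: jet_exp; jets
  | exact: jetC | exact: jetX | exact: jet1 | exact: jet_nat ].

Section LeadJet.
Variables (R : comNzRingType) (e : R) (A B : {poly R}) (a a' b b' : R).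
Hypotheses (jA : jet A = (a, a')) (jB : jet B = (b, b')).

Lemma jet_leadw : jet (leadw e%:P 'X A B) = (e, 0).
Proof. by etransitivity; [rewrite /leadw; jets | congr (_, _); ring]. Qed.
Lemma jet_leadf : jet (leadf e%:P 'X A B) = (b, b' - 3 * e ^+ 2 * a ^+ 2).
Proof.
have j := jet_leadw; rewrite /leadf; move: (leadw _ _ _ _) j => w j.
by etransitivity; [jets | congr (_, _); ring].
Qed.
Lemma jet_leadg : jet (leadg e%:P 'X A B) = (b, b' - 2 * e ^+ 2 * a ^+ 2).
Proof.
have j := jet_leadw; rewrite /leadg; move: (leadw _ _ _ _) j => w j.
by etransitivity; [jets | congr (_, _); ring].
Qed.
Lemma jet_leadq : jet (leadq e%:P 'X A B) = (e ^+ 3 * a, b ^+ 2 + e ^+ 3 * a').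
Proof.
have j := jet_leadw; have j1 := jet_leadf; have j2 := jet_leadg; rewrite /leadq.
move: (leadw _ _ _ _) (leadf _ _ _ _) (leadg _ _ _ _) j j1 j2 => w f g j j1 j2.
by etransitivity; [jets | congr (_, _); ring].
Qed.
Lemma jet_lead : jet (lead e%:P 'X A B) =
  ((b + e ^+ 2 * a) ^+ 2 * (b + e * a),
   (2 + e) * a * b ^+ 3 - 7 * e ^+ 2 * a ^+ 2 * b ^+ 2
   - (6 * e ^+ 3 + 12 * e ^+ 4) * a ^+ 3 * b - (6 * e ^+ 5 + 3 * e ^+ 6) * a ^+ 4
   + (b + e ^+ 2 * a) ^+ 2 * (b' + e * a')
   + 2 * (b + e ^+ 2 * a) * (b' + e ^+ 2 * a') * (b + e * a)).
Proof.
have j := jet_leadw; have j1 := jet_leadf; have j2 := jet_leadg; have j3 := jet_leadq.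
rewrite /lead; move: (leadw _ _ _ _) (leadf _ _ _ _) (leadg _ _ _ _) (leadq _ _ _ _) j j1 j2 j3.
move=> w f g q j j1 j2 j3.
by etransitivity; [jets | congr (_, _); ring].
Qed.
End LeadJet.

Section MultiplicitySequence.
Variables (k : closedFieldType) (e : k).
Hypothesis e0 : e != 0.
Local Notation E := (e%:MP_[2] : {mpoly k[2]}).
Local Notation X := ('X_0 : {mpoly k[2]}).
Local Notation V := ('X_1 : {mpoly k[2]}).

Lemma tower_congr (R : comNzRingType) (c d x y v w : R) i :
  c = d -> x = y -> v = w -> tower c i x v = tower d i y w.
Proof. by move=> -> -> ->. Qed.

Definition parc2 (a b : {poly k}) := parc (fun i : 'I_2 => if i == 0 then a else b).
Lemma parc2_tower a b i : parc2 a b (tower E i X V) = tower e%:P i a b.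
Proof. by rewrite tower_map /parc2 arcC !arcX. Qed.

Lemma tower_mult i : (i < 7)%N -> mult0 (tower E i X V) 3.
Proof.
move=> i7; set g := tower E i X V.
have o3 : ordge 3 g by exact: ordge_tower.
have [c gc] := tower_x0 e%:P 'X i7; rewrite -parc2_tower -/g in gc.
have /hasP [m sm /eqP dm] : has (fun m => mdeg m == 3) (msupp g).
  apply: contraT => /hasPn none.
  have [||Q EQ] := @arc_order _ _ 4 (fun i : 'I_2 => if i == 0 then 0 else 'X) g _ _.
  - by move=> j; case: (j == 0); [exists 0; rewrite mulr0 | exists 1; rewrite mulr1].
  - by move=> m sm; rewrite ltn_neqAle eq_sym none // o3.
  move: gc; rewrite /parc2 EQ => /(congr1 (fun p : {poly k} => p`_3)).
  rewrite coefXnM /= coefXnM /= subnn coefD coef1 coefXM /= addr0 => /eqP.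
  by rewrite eq_sym oner_eq0.
split; last by split; [exact: o3 | exists m].
by apply/eqP => g0; move: sm; rewrite g0 msupp0.
Qed.

Definition comp2 n (T : n.-tuple {mpoly k[2]}) : {rmorphism {mpoly k[n]} -> {mpoly k[2]}} :=
  comp_mpoly T.
Lemma comp2C n (T : n.-tuple {mpoly k[2]}) c : comp2 T c%:MP = c%:MP.
Proof. exact: comp_mpolyC. Qed.
Lemma comp2X n (T : n.-tuple {mpoly k[2]}) i : comp2 T 'X_i = tnth T i.
Proof. by rewrite (tnth_nth 0) [LHS]comp_mpolyXU. Qed.

Definition shear_mx (c : k) : 'M[k]_2 :=
  \matrix_(i, j) (if i == j then 1 else if i == 1 then c else 0).

Lemma ord2P (i : 'I_2) : i = 0 \/ i = 1.
Proof. by case: i => [[|[|//]] h]; [left|right]; exact: val_inj. Qed.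

Lemma shear_unit c : shear_mx c \in unitmx.
Proof.
suff /mulmx1_unit [] : shear_mx c *m shear_mx (- c) = 1%:M by [].
apply/matrixP => i j; rewrite !mxE big_ord_recr big_ord_recr big_ord0 /= add0r.
have -> : widen_ord (leqnSn 1) ord_max = 0 :> 'I_2 by exact: val_inj.
have -> : ord_max = 1 :> 'I_2 by exact: val_inj.
rewrite !mxE.
by case: (ord2P i) => ->; case: (ord2P j) => ->; rewrite /= ?(mulr1, mul1r, mul0r, mulr0, add0r, addr0) // subrr.
Qed.

Lemma tower_strict i : (i < 6)%N ->
  strict_transform (tower E i X V \mPo lin2 (shear_mx (shear e i))) 3 (tower E i.+1 X V).
Proof.
move=> i6; rewrite /strict_transform -(tower_step E X V i6).
transitivity (comp2 (blowup_subst k) (comp2 (lin2 (shear_mx (shear e i))) (tower E i X V))).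
  by [].
rewrite [X in comp2 _ X]tower_map tower_map; apply: tower_congr.
- by rewrite comp2C [LHS]comp2C.
- rewrite comp2X tnth_mktuple !mxE -!mul_mpolyC rmorphD !rmorphM !comp2C !comp2X.
  by rewrite mpolyC0 mpolyC1 mul0r addr0 mul1r.
rewrite comp2X tnth_mktuple !mxE -!mul_mpolyC rmorphD !rmorphM !comp2C !comp2X mpolyC1 mul1r.
congr (_ * _ + _).
by case: i {i6} => [|[|[|[|[|i]]]]]; rewrite ?mpolyC0 ?mpolyC1.
Qed.

(* If [s] had multiplicity at least 2, the first two coefficients of [lead]
   would vanish along the arcs [(X, c X)] of the blown-up chart, for [c = 0, 1]. *)
Lemma tower_last (L : 'M[k]_2) s m : L \in unitmx ->
  strict_transform (tower E 6 X V \mPo lin2 L) 3 s -> mult0 s m -> (m <= 1)%N.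
Proof.
move=> uL str [_ [om _]]; rewrite leqNgt; apply/negP => m2.
have jC (c d : k) : jet (c%:P + d%:P * 'X) = (c, d).
  by etransitivity; [jets | congr (_, _); ring].
have key c : jet (lead e%:P 'X ((L 0 0)%:P + (L 0 1 * c)%:P * 'X)
    ((L 1 0)%:P + (L 1 1 * c)%:P * 'X)) = (0, 0).
  pose h := parc2 'X (c%:P * 'X).
  have hC d : h d%:MP = d%:P by exact: arcC.
  have hX : h X = 'X by exact: arcX.
  have hV : h V = c%:P * 'X by exact: arcX.
  have [|Q EQ] := @arc_order _ _ m (fun i : 'I_2 => if i == 0 then 'X else c%:P * 'X) s _ om.
    by move=> j; case: (j == 0); [exists 1; rewrite mulr1 | exists c%:P; rewrite mulrC].
  have := congr1 h str.
  rewrite -[X in h X = _]/(comp2 (blowup_subst k) (comp2 (lin2 L) (tower E 6 X V))).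
  rewrite rmorphM rmorphXn hX [h s]EQ.
  have lE i : h (comp2 (blowup_subst k) (L i 0 *: X + L i 1 *: V))
      = 'X * ((L i 0)%:P + (L i 1 * c)%:P * 'X).
    rewrite -!mul_mpolyC !(rmorphD, rmorphM) !comp2C !comp2X.
    have -> : tnth (blowup_subst k) 0 = X by [].
    have -> : tnth (blowup_subst k) 1 = X * V by [].
    by rewrite rmorphM !hC hX hV; ring.
  have -> : h (comp2 (blowup_subst k) (comp2 (lin2 L) (tower E 6 X V))) =
      tower e%:P 6 ('X * ((L 0 0)%:P + (L 0 1 * c)%:P * 'X))
                   ('X * ((L 1 0)%:P + (L 1 1 * c)%:P * 'X)).
    rewrite [X in comp2 _ X]tower_map [X in h X]tower_map tower_map; apply: tower_congr.
    - by rewrite comp2C [X in h X]comp2C hC.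
    - by rewrite comp2X tnth_mktuple lE.
    by rewrite comp2X tnth_mktuple lE.
  rewrite tower6_lead => /mulfI -> //; last by rewrite expf_neq0 ?polyX_eq0.
  rewrite -(subnK m2) addn2 !exprS -!mulrA.
  have j (p : {poly k}) : exists d d', jet p = (d, d') by exists p.[0], (p^`()).[0].
  have [d [d' jd]] := j ('X^(m - 2) * Q).
  by etransitivity; [jets | congr (_, _); ring].
have K0 := key 0; have K1 := key 1.
rewrite (jet_lead e (jC _ _) (jC _ _)) in K0.
rewrite (jet_lead e (jC _ _) (jC _ _)) in K1.
rewrite !mulr1 in K1; rewrite !mulr0 !(mulr0, addr0, mul0r) in K0.
case: K0 => P3; case: K1 => _ K1 P4; move: K1; rewrite P4 add0r => K1.
have row_sing (c d : k) : (c != 0) || (d != 0) -> c * L 0 0 + d * L 1 0 = 0 ->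
    c * L 0 1 + d * L 1 1 = 0 -> False.
  move=> cd0 h0 h1; pose u : 'rV[k]_2 := \row_j (if j == 0 then c else d).
  have u0L : u *m L = 0.
    apply/rowP => j; rewrite !mxE big_ord_recr big_ord_recr big_ord0 /= add0r !mxE.
    have -> : widen_ord (leqnSn 1) ord_max = 0 :> 'I_2 by exact: val_inj.
    have -> : ord_max = 1 :> 'I_2 by exact: val_inj.
    by case: (ord2P j) => ->.
  have : u = 0 by rewrite -[u](mulmxK uL) u0L mul0mx.
  move/rowP => u0; move: cd0 (u0 0) (u0 1); rewrite !mxE /= => + c0 d0.
  by rewrite c0 d0 eqxx.
move: (L 0 0) (L 0 1) (L 1 0) (L 1 1) P3 P4 K1 row_sing => a a' b b' P3 P4 K1 row_sing.
(* On the double tangent the linear term reduces to - e^7 a^4, so a = 0, hence b = 0, and L is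
   singular. On the simple tangent it forces b' + e a' = 0, so (e, 1) kills both columns of L. *)
have [b1|b1] := eqVneq (b + e ^+ 2 * a) 0.
  have bE : b = - (e ^+ 2 * a) by apply/eqP; rewrite -addr_eq0 b1.
  move: P4; rewrite bE.
  have -> : (2 + e) * a * (- (e ^+ 2 * a)) ^+ 3
    - 7 * e ^+ 2 * a ^+ 2 * (- (e ^+ 2 * a)) ^+ 2
    - (6 * e ^+ 3 + 12 * e ^+ 4) * a ^+ 3 * (- (e ^+ 2 * a))
    - (6 * e ^+ 5 + 3 * e ^+ 6) * a ^+ 4 = - (e ^+ 7 * a ^+ 4) by ring.
  move/eqP; rewrite oppr_eq0 mulf_eq0 !expf_eq0 (negPf e0) => /eqP a0.
  rewrite a0 mulr0 oppr0 in bE.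
  have [a1|b'0] := eqVneq b' 0.
    by apply: (row_sing 0 1); rewrite ?oner_eq0 ?orbT // ?bE ?a1 ?a0; ring.
  by apply: (row_sing b' (- a')); rewrite ?b'0 // ?a0 ?bE; ring.
have bE : b + e * a = 0.
  by move/eqP: P3; rewrite mulf_eq0 expf_eq0 (negPf b1) => /eqP.
move: K1; rewrite bE mulr0 addr0 => /eqP; rewrite mulf_eq0 expf_eq0 (negPf b1) => /eqP K1.
by apply: (row_sing e 1); rewrite ?oner_eq0 ?orbT // mul1r addrC.
Qed.

Lemma octic_mult_seq : mult_seq_3_7 (octic e).
Proof.
exists 1%:M, (fun i => shear_mx (shear e i)), (fun i => tower E i X V).
split; first exact: unitmx1.
split; first by move=> i _; exact: shear_unit.
split.
  pose h : {rmorphism {mpoly k[3]} -> {mpoly k[2]}} := comp2 (chart_subst 1%:M).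
  rewrite -[RHS]/(h (octic e)) -oct_map [h _]comp2C; congr oct.
  rewrite /map3 /X3 /h !comp2X !tnth_mktuple !mxE /=.
  by rewrite !(scale0r, scale1r) !mpolyC0 mpolyC1 !(add0r, addr0).
split; first exact: tower_mult.
split; first exact: tower_strict.
split; first by move=> L uL s m; exact: tower_last.
move=> q q0 Fq nq B uB Bq m; apply: (octic_smooth e0 Fq) => //.
apply/eqP => f0; apply: nq.
have g0 : oct e (tr q) = 0 by rewrite -ev_octic.
have [x0 y0] := cub_oct_eq0 e0 f0 g0.
have z0 : q ord_max 0 != 0.
  by apply: contra q0 => /eqP z0; rewrite -tr_eq0 /tr x0 y0 z0.
exists (q ord_max 0) => //; apply/colP => i; rewrite !mxE.
by case: (ord3P i) => ->; rewrite ?x0 ?y0 /= ?mulr0 ?mulr1.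
Qed.
End MultiplicitySequence.

(** * Parametrization and projective inequivalence *)

Section Parametrization.
Variable R : comNzRingType.
Implicit Types (e u t : R) (v : R * R * R).

(** Here x + y = (1 - e) t and x + e y = (1 - e) u, so [cub] restricts to a multiple of u t^2: t = 0
    is the point of tangency r and u = 0 the residual point s. *)
Definition line_pt e u t : R * R * R :=
  (u - e * t, t - u, - (1 - e) * (u + (1 + e) * t)).
Definition gam e u t := phi e (line_pt e u t).
Definition nn_ e v := x3_ e v + e * x2_ v * cub e v.

Lemma lin_line e u t : lin e (line_pt e u t) = 0.
Proof. by rewrite /lin /line_pt; ring. Qed.
Lemma cub_line e u t : cub e (line_pt e u t) = - (1 - e) ^+ 3 * u * t ^+ 2.
Proof. by rewrite /cub /line_pt; ring. Qed.
Lemma x2_line e u t :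
  x2_ (line_pt e u t) = - (e * u ^+ 2 + e * (e - 3) * u * t + t ^+ 2).
Proof. by rewrite /x2_ /line_pt; ring. Qed.

(** Coefficients of [x3_] (and of [z2_] in [zc]) expanded along the line. The extreme ones, -1 and
    e^3 here, -1 and -e^5 in [zc], are those read off later. *)
Definition qc e (i : nat) : R := nth 0 [:: - 1; - 1 + 9 * e - 3 * e ^+ 2;
  - 15 * e ^+ 2 - 2 * e ^+ 3 + 12 * e ^+ 4 - 6 * e ^+ 5 + e ^+ 6;
  3 * e ^+ 2 + 19 * e ^+ 3 - 15 * e ^+ 4 + 3 * e ^+ 5;
  - 8 * e ^+ 3 + 3 * e ^+ 4; e ^+ 3] i.
Definition zc e (i : nat) : R := nth 0 [:: - 1; - 2 + 15 * e - 5 * e ^+ 2;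
  - 1 + 13 * e - 70 * e ^+ 2 + 20 * e ^+ 3 + 20 * e ^+ 4 - 12 * e ^+ 5 + 2 * e ^+ 6;
  - 8 * e ^+ 2 + 122 * e ^+ 3 - 14 * e ^+ 4 - 68 * e ^+ 5 + 48 * e ^+ 7
    - 32 * e ^+ 8 + 9 * e ^+ 9 - e ^+ 10;
  2 * e ^+ 2 - 22 * e ^+ 3 - 135 * e ^+ 4 + 20 * e ^+ 5 + 160 * e ^+ 6
    - 132 * e ^+ 7 + 42 * e ^+ 8 - 5 * e ^+ 9;
  50 * e ^+ 4 + 111 * e ^+ 5 - 165 * e ^+ 6 + 70 * e ^+ 7 - 10 * e ^+ 8;
  - 5 * e ^+ 4 - 63 * e ^+ 5 + 50 * e ^+ 6 - 10 * e ^+ 7;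
  13 * e ^+ 5 - 5 * e ^+ 6; - e ^+ 5] i.

Lemma x3_line e u t :
  x3_ e (line_pt e u t) = \sum_(i < 6) qc e i * u ^+ i * t ^+ (5 - i).
Proof.
rewrite /x3_ [line_pt e u t]/line_pt -/(line_pt e u t) cub_line x2_line.
rewrite !big_ord_recr big_ord0 /= /z1_ /line_pt /qc /=; ring.
Qed.
Lemma z2_line e u t :
  z2_ e (line_pt e u t) = \sum_(i < 9) zc e i * u ^+ i * t ^+ (8 - i).
Proof.
rewrite /z2_ [line_pt e u t]/line_pt -/(line_pt e u t) cub_line x2_line.
rewrite !big_ord_recr big_ord0 /= /z1_ /line_pt /zc /=; ring.
Qed.

Lemma gam_scal e c u t : gam e (c * u) (c * t) = scal (c ^+ 8) (gam e u t).
Proof.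
rewrite /gam -phi_scal; congr (phi e _).
by rewrite /line_pt /scal; congr (_, _, _); ring.
Qed.
Lemma oct_gam e u t : oct e (gam e u t) = 0.
Proof. by rewrite oct_phi lin_line mulr0. Qed.
Lemma cub_gam e u t : cub e (gam e u t) = e * ((1 - e) ^+ 3 * u * t ^+ 2) ^+ 8.
Proof. by rewrite cubphi cub_line; ring. Qed.

(* [nn_ : tt_] inverts the parametrization [gam]. *)
Lemma gam_nn_tt e v : oct e v = 0 ->
  scal (cub e v ^+ 8) (gam e (nn_ e v) (tt_ e v))
  = scal ((1 - e) ^+ 8 * (e ^+ 3 * cub e v ^+ 21)) v.
Proof.
move=> g0; rewrite -[RHS]scalA -phi_phi -!phi_scal; congr (phi e _).
move: g0; rewrite octE /phi /line_pt /nn_ /tt_ /scal.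
move: (x3_ e v) (x2_ v) (cub e v) (z2_ e v) => q p f r /eqP.
rewrite -addrA addr_eq0 => /eqP ->.
by congr (_, _, _); ring.
Qed.
Lemma cub_lin0 e x y z : lin e (x, y, z) = 0 ->
  cub e (x, y, z) = - ((x + y) ^+ 2 * (x + e * y)).
Proof.
rewrite /lin /cub -addrA => /eqP; rewrite addr_eq0 => /eqP ->; ring.
Qed.
End Parametrization.

(** Since [phi v] is on the line, [cub (phi v)] is computed both by [cubphi] and by [cub_lin0]. So
    neither parameter vanishes at a point of the octic off the cubic. *)
Lemma tt_nn (R : idomainType) (e : R) v : oct e v = 0 -> cub e v != 0 ->
  tt_ e v ^+ 2 * nn_ e v = - (e * cub e v ^+ 5).
Proof.
move=> g0 f0; have := cubphi e v; rewrite cub_lin0 // => E.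
have h : cub e v ^+ 3 != 0 by rewrite expf_neq0.
apply: (mulfI h); have -> : cub e v ^+ 3 * - (e * cub e v ^+ 5) = - (e * cub e v ^+ 8) by ring.
by rewrite -E /tt_ /nn_; ring.
Qed.

Section ParametrizationMap.
Variables (R S : comNzRingType) (h : {rmorphism R -> S}).
Lemma gam_map e u t : gam (h e) (h u) (h t) = map3 h (gam e u t).
Proof.
rewrite /gam -phi_map; congr (phi _ _).
by rewrite /line_pt /map3 /= !(rmorphE, rmorphM).
Qed.
Lemma qc_map e i : qc (h e) i = h (qc e i).
Proof.
rewrite /qc; case: i => [|[|[|[|[|[|i]]]]]] /=; rewrite ?nth_nil;
by rewrite !(rmorph_nat, rmorphM, rmorphXn, rmorphB, rmorphD, rmorphN, rmorph1, rmorph0).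
Qed.
Lemma zc_map e i : zc (h e) i = h (zc e i).
Proof.
rewrite /zc; case: i => [|[|[|[|[|[|[|[|[|i]]]]]]]]] /=; rewrite ?nth_nil;
by rewrite !(rmorph_nat, rmorphM, rmorphXn, rmorphB, rmorphD, rmorphN, rmorph1, rmorph0).
Qed.
Definition act (A : 'M[R]_3) (v : R * R * R) : R * R * R :=
  let: (x, y, z) := v in
  (A 0 0 * x + A 0 1 * y + A 0 ord_max * z,
   A 1 0 * x + A 1 1 * y + A 1 ord_max * z,
   A ord_max 0 * x + A ord_max 1 * y + A ord_max ord_max * z).
End ParametrizationMap.

Section UnivariateFacts.
Variable k : closedFieldType.
Implicit Types p q : {poly k}.

Lemma poly_root0_monomial p : (forall x, x != 0 -> p.[x] != 0) ->
  exists c n, c != 0 /\ p = c%:P * 'X^n.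
Proof.
have [m] := ubnP (size p); elim: m p => // m IH p sp h.
have [p0|p0] := eqVneq p.[0] 0.
  have /factor_theorem [q qE] : root p 0 by apply/rootP.
  rewrite polyC0 subr0 in qE.
  have q0 x : x != 0 -> q.[x] != 0.
    by move=> /h; rewrite qE hornerMX mulf_eq0 negb_or => /andP[].
  have qn0 : q != 0.
    by apply/eqP => qz; move: (q0 1 (oner_neq0 _)); rewrite qz horner0 eqxx.
  have [|c [n [c0 qc]]] := IH q _ q0.
    by move: sp; rewrite qE size_mulX // ltnS => /ltnW; rewrite ltnS.
  by exists c, n.+1; split=> //; rewrite qE qc exprSr mulrA.
have [|c pE] := @poly_noroot _ p.
  by move=> x; have [->|/h] := eqVneq x 0.
exists c, 0; rewrite expr0 mulr1; split=> //.
by apply: contra p0; rewrite pE hornerC.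
Qed.

Lemma coprimep_noroot p q : (forall x, p.[x] = 0 -> q.[x] = 0 -> False) -> coprimep p q.
Proof.
move=> h; rewrite /coprimep; apply: contraT => /closed_rootP [x].
by rewrite root_gcd => /andP[/rootP px /rootP qx]; case: (h x).
Qed.
End UnivariateFacts.

Section LinearAction.
Variable R : comNzRingType.
Implicit Types (A B : 'M[R]_3) (v : R * R * R).

Lemma act_scal A c v : act A (scal c v) = scal c (act A v).
Proof. by case: v => [[x y] z]; rewrite /act /scal; congr (_, _, _); ring. Qed.
Lemma act_mul A B v : act A (act B v) = act (A *m B) v.
Proof.
by case: v => [[x y] z]; rewrite /act !mxE !big_ord3 /=; congr (_, _, _); ring.
Qed.
Lemma act1 v : act 1%:M v = v.
Proof. by case: v => [[x y] z]; rewrite /act !mxE /=; congr (_, _, _); ring. Qed.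
End LinearAction.

Lemma act_map (R S : comNzRingType) (h : {rmorphism R -> S}) A v :
  act (map_mx h A) (map3 h v) = map3 h (act A v).
Proof.
by case: v => [[x y] z]; rewrite /act /map3 !mxE /=; congr (_, _, _);
   rewrite !(rmorphD, rmorphM).
Qed.

Section Branches.
Variables (k : closedFieldType) (e : k).
Hypotheses (e0 : e != 0) (e1 : 1 - e != 0).

Definition atx (x : k) : {rmorphism {poly k} -> k} := horner_eval x.
Lemma atxE x p : atx x p = p.[x]. Proof. by []. Qed.
Lemma atxC x c : atx x c%:P = c. Proof. exact: hornerC. Qed.

(** Both r and s go to the node; by [cub_gam_neq0] no other parameter does. *)
Lemma gam10 : gam e 1 0 = (0, 0, - e ^+ 5).
Proof.
have E : line_pt e 1 0 = (1, -1, - (1 - e)) by rewrite /line_pt; congr (_, _, _); ring.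
have f0 : cub e (line_pt e 1 0) = 0 by rewrite cub_line; ring.
rewrite /gam /phi f0; congr (_, _, _); [ring | ring |].
by rewrite z2_line !big_ord_recr big_ord0 /= /zc /=; ring.
Qed.
Lemma gam01 : gam e 0 1 = (0, 0, -1).
Proof.
have f0 : cub e (line_pt e 0 1) = 0 by rewrite cub_line; ring.
rewrite /gam /phi f0; congr (_, _, _); [ring | ring |].
by rewrite z2_line !big_ord_recr big_ord0 /= /zc /=; ring.
Qed.
Lemma cub_gam_neq0 u t : u != 0 -> t != 0 -> cub e (gam e u t) != 0.
Proof.
move=> u0 t0; rewrite cub_gam; apply: mulf_neq0 => //; apply: expf_neq0.
by rewrite !mulf_neq0 ?expf_neq0.
Qed.
Lemma gam_neq0 u t : (u, t) != (0, 0) -> gam e u t <> (0, 0, 0).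
Proof.
move=> ut E; have [u0|u0] := eqVneq u 0; last have [t0|t0] := eqVneq t 0.
- have t0 : t != 0 by apply: contra ut => /eqP ->; rewrite u0.
  move: E; have -> : gam e u t = gam e (t * 0) (t * 1) by rewrite u0 mulr0 mulr1.
  rewrite gam_scal gam01 /scal => -[_ _ /eqP].
  by rewrite mulrN1 oppr_eq0 expf_eq0 (negPf t0).
- move: E; have -> : gam e u t = gam e (u * 1) (u * 0) by rewrite t0 mulr0 mulr1.
  rewrite gam_scal gam10 /scal => -[_ _ /eqP].
  by rewrite mulf_eq0 oppr_eq0 !expf_eq0 (negPf u0) (negPf e0).
by have := cub_gam_neq0 u0 t0; rewrite E /cub => /eqP []; ring.
Qed.

(** The second and third coordinates of [gam] have no common zero. Off the cubic such a zero forces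
    x = 0 and y z = 0 through the exchange relations, and 1 + 2 e nonzero keeps (0 : 1 : 0) off the
    line. *)
Lemma line_coprime u t : 1 + 2 * e != 0 -> (u, t) != (0, 0) ->
  x2_ (line_pt e u t) * cub e (line_pt e u t) ^+ 2 = 0 ->
  z2_ e (line_pt e u t) = 0 -> False.
Proof.
move=> e2 ut pf r0.
have [f0|f0] := eqVneq (cub e (line_pt e u t)) 0.
  apply: (gam_neq0 ut); rewrite /gam /phi f0 r0.
  by congr (_, _, _); ring.
have p0 : x2_ (line_pt e u t) = 0.
  by move/eqP: pf; rewrite mulf_eq0 expf_eq0 (negPf f0) andbF orbF => /eqP.
have := lin_line e u t; move: (line_pt e u t) f0 p0 r0 => [[x y] z] f0 p0 r0 l0.
have := z2_rel_z1 e x y z; rewrite r0 p0 expr0n !mulr0 subrr => /esym/eqP.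
rewrite mulf_eq0 expf_eq0 (negPf f0) => /eqP w0.
have := z1_rel e x y z; rewrite w0 p0 expr0n mulr0 addr0 => /esym/eqP.
rewrite mulf_eq0 (negPf f0) orbF => /eqP x0.
move: p0; rewrite /x2_ x0 expr0n subr0 => /eqP; rewrite mulf_eq0 => /orP[] /eqP yz.
  by move: f0; rewrite /cub x0 yz => /eqP []; ring.
move: l0; rewrite /lin x0 yz mulr0 addr0 add0r => /eqP.
rewrite mulf_eq0 (negPf e2) => /eqP y0.
by move: f0; rewrite /cub x0 y0 => /eqP []; ring.
Qed.

Let zn : {poly k} := \poly_(i < 9) zc e i.
Let qn : {poly k} := \poly_(i < 6) qc e i.

Lemma gam_X1 : gam e%:P 'X 1 =
  ((- (1 - e) ^+ 3)%:P * qn * 'X,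
   (- (1 - e) ^+ 6)%:P * (e%:P * 'X^2 + (e * (e - 3))%:P * 'X + 1) * 'X^2, zn).
Proof.
have qE : x3_ e%:P (line_pt e%:P 'X 1) = qn.
  rewrite x3_line /qn poly_def; apply: eq_bigr => i _.
  by rewrite expr1n mulr1 qc_map mul_polyC.
have zE : z2_ e%:P (line_pt e%:P 'X 1) = zn.
  rewrite z2_line /zn poly_def; apply: eq_bigr => i _.
  by rewrite expr1n mulr1 zc_map mul_polyC.
rewrite /gam /phi qE zE cub_line x2_line.
by congr (_, _, _); rewrite !(rmorphN, rmorphXn, rmorphM, rmorphB, rmorph1, rmorph_nat); ring.
Qed.
End Branches.

Section RowCombination.
Variables (k : closedFieldType) (e : k).
Hypotheses (e0 : e != 0) (e1 : 1 - e != 0).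

Definition row_comb (c : k * k * k) : {poly k} :=
  let g := gam e%:P 'X 1 in
  c.1.1%:P * g.1.1 + c.1.2%:P * g.1.2 + c.2%:P * g.2.

Lemma coef_row_comb c j : (row_comb c)`_j =
  c.1.1 * (- (1 - e) ^+ 3 * (if j == 0%N then 0 else if (j.-1 < 6)%N then qc e j.-1 else 0))
  + c.1.2 * (- (1 - e) ^+ 6 * (e * (j == 4)%:R + e * (e - 3) * (j == 3)%:R + (j == 2)%:R))
  + c.2 * (if (j < 9)%N then zc e j else 0).
Proof.
have -> : row_comb c =
    (c.1.1 * - (1 - e) ^+ 3)%:P * (\poly_(i < 6) qc e i * 'X)
    + (c.1.2 * - (1 - e) ^+ 6)%:P * (e%:P * 'X^4 + (e * (e - 3))%:P * 'X^3 + 'X^2)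
    + c.2%:P * \poly_(i < 9) zc e i.
  rewrite /row_comb gam_X1 !polyCM; move: (_%:P) (\poly_(i < 6) _) => p q.
  by move: (- (1 - e) ^+ 6)%:P (e - 3)%:P (\poly_(i < 9) _) => a b r /=; ring.
rewrite !(coefD, coefCM) coefMX !coefXn !coef_poly.
move: (j == 4)%:R (j == 3)%:R (j == 2)%:R => d4 d3 d2.
by case: (j == 0)%N; case: (j.-1 < 6)%N; case: (j < 9)%N; ring.
Qed.

Lemma size_row_comb c : (size (row_comb c) <= 9)%N.
Proof.
apply/leq_sizeP => j j9; rewrite -(subnK j9) !addnS addn0 coef_row_comb /=; ring.
Qed.

Let c3 : (1 - e) ^+ 3 != 0. Proof. exact: expf_neq0. Qed.
Let c6 : (1 - e) ^+ 6 != 0. Proof. exact: expf_neq0. Qed.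

Lemma row_comb0 c : (row_comb c)`_0 = - c.2.
Proof. by rewrite coef_row_comb /= /zc /=; ring. Qed.
Lemma row_comb1 x y : (row_comb (x, y, 0))`_1 = x * (1 - e) ^+ 3.
Proof. by rewrite coef_row_comb /= /qc /=; ring. Qed.
Lemma row_comb6 x y : (row_comb (x, y, 0))`_6 = - x * ((1 - e) ^+ 3 * e ^+ 3).
Proof. by rewrite coef_row_comb /= /qc /=; ring. Qed.
Lemma row_comb2 y : (row_comb (0, y, 0))`_2 = - (y * (1 - e) ^+ 6).
Proof. by rewrite coef_row_comb /=; ring. Qed.
Lemma row_comb3 y : (row_comb (0, y, 0))`_3 = - (y * (1 - e) ^+ 6) * (e * (e - 3)).
Proof. by rewrite coef_row_comb /=; ring. Qed.
Lemma row_comb4 y : (row_comb (0, y, 0))`_4 = - (y * (1 - e) ^+ 6) * e.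
Proof. by rewrite coef_row_comb /=; ring. Qed.

Lemma row_comb_lin c d x y : row_comb c * x%:P - row_comb d * y%:P =
  row_comb (c.1.1 * x - d.1.1 * y, c.1.2 * x - d.1.2 * y, c.2 * x - d.2 * y).
Proof.
rewrite /row_comb; case: (gam _ _ _) => [[g0 g1] g2] /=.
by rewrite !polyCB !polyCM; ring.
Qed.

(** The octic lies on no line: the coefficients 0, 1, 2 are triangular in the entries of c. *)
Lemma row_comb_eq0 c : row_comb c = 0 -> c = (0, 0, 0).
Proof.
case: c => [[x y] z] R0.
have z0 : z = 0.
  by have := row_comb0 (x, y, z); rewrite R0 coef0 => /esym/eqP; rewrite oppr_eq0 => /eqP.
rewrite z0 in R0 *; have := row_comb1 x y; rewrite R0 coef0 => /esym/eqP.
rewrite mulf_eq0 (negPf c3) orbF => /eqP x0; rewrite x0 in R0 *.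
have := row_comb2 y; rewrite R0 coef0 => /esym/eqP.
by rewrite oppr_eq0 mulf_eq0 (negPf c6) orbF => /eqP ->.
Qed.
End RowCombination.

Section NonEquivalence.
Variable k : closedFieldType.

Lemma tr_mulmx (A : 'M[k]_3) p : tr (A *m p) = act A (tr p).
Proof. by rewrite /tr /act !mxE !big_ord3. Qed.

Lemma par_colinear (v b : k * k * k) : b <> (0, 0, 0) -> par v b ->
  exists c, v = scal c b.
Proof.
case: v b => [[x y] z] [[x' y'] z'] b0 [E1 E2 E3].
have [x0|x0] := eqVneq x' 0; last first.
  exists (x / x'); rewrite /scal; congr (_, _, _); first by rewrite divfK.
    by apply: (mulIf x0); rewrite [RHS]mulrAC divfK.
  by apply: (mulIf x0); rewrite [RHS]mulrAC divfK.
have [y0|y0] := eqVneq y' 0; last first.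
  exists (y / y'); rewrite /scal; congr (_, _, _); last first.
  - by apply: (mulIf y0); rewrite [RHS]mulrAC divfK.
  - by rewrite divfK.
  by apply: (mulIf y0); rewrite E1 x0 !mulr0 mul0r.
have [z0|z0] := eqVneq z' 0; first by case: b0; rewrite x0 y0 z0.
exists (z / z'); rewrite /scal; congr (_, _, _); last by rewrite divfK.
  by apply: (mulIf z0); rewrite E2 x0 !mulr0 mul0r.
by apply: (mulIf z0); rewrite E3 y0 !mulr0 mul0r.
Qed.

Variables (e e' : k).
Hypotheses (ee' : e * e' = 1) (e1 : 1 - e != 0) (e1' : 1 - e' != 0).
Hypotheses (h2' : 1 + 2 * e' != 0).
Let e0 : e != 0.
Proof. by apply/eqP => E; move/eqP: ee'; rewrite E mul0r eq_sym oner_eq0. Qed.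
Let e'0 : e' != 0.
Proof. by apply/eqP => E; move/eqP: ee'; rewrite E mulr0 eq_sym oner_eq0. Qed.
Variable A : 'M[k]_3.
Hypothesis uA : A \in unitmx.
Hypothesis HA : forall v, v <> (0, 0, 0) -> oct e v = 0 -> oct e' (act A v) = 0.
Hypothesis HA' : forall v, v <> (0, 0, 0) -> oct e' (act A v) = 0 -> oct e v = 0.

Lemma actK v : act (invmx A) (act A v) = v.
Proof. by rewrite act_mul mulVmx // act1. Qed.
Lemma actVK v : act A (act (invmx A) v) = v.
Proof. by rewrite act_mul mulmxV // act1. Qed.
Lemma act0 (B : 'M[k]_3) : act B (0, 0, 0) = (0, 0, 0).
Proof. by rewrite /act !mulr0 !addr0. Qed.
Lemma act_neq0 v : v <> (0, 0, 0) -> act A v <> (0, 0, 0).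
Proof. by move=> v0 E; apply: v0; rewrite -(actK v) E act0. Qed.
Lemma row_free3 c0 c1 c2 :
  (forall j, c0 * A 0 j + c1 * A 1 j + c2 * A ord_max j = 0) ->
  [/\ c0 = 0, c1 = 0 & c2 = 0].
Proof.
move=> h; pose u : 'rV[k]_3 := \row_j comp3 (c0, c1, c2) j.
have uA0 : u *m A = 0.
  by apply/rowP => j; rewrite !mxE big_ord3 /= !mxE; exact: h.
have /rowP u0 : u = 0 by rewrite -[u](mulmxK uA) uA0 mul0mx.
by split; [have := u0 0 | have := u0 1 | have := u0 ord_max]; rewrite !mxE.
Qed.

(* [a] is the image by [A] of a moving point of the first octic. As it lies on the
   second octic, [gam_nn_tt] turns it into a point of the parametrization of the
   latter, given by polynomials [N] and [D]. *)
Section Moving.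
Variables (U T : {poly k}).
Hypothesis UT : forall x, (U.[x], T.[x]) != (0, 0).
Let a := act (map_mx polyC A) (gam e%:P U T).
Let f := cub e'%:P a.
Let D := tt_ e'%:P a.
Let N := nn_ e'%:P a.

Lemma at_moving x : map3 (atx x) a = act A (gam e U.[x] T.[x]).
Proof.
rewrite /a -act_map -gam_map atxC; congr act.
by apply/matrixP => i j; rewrite !mxE atxC.
Qed.
Lemma oct_moving : oct e'%:P a = 0.
Proof.
apply: poly_horner_eq0 => x; rewrite -atxE -oct_map atxC at_moving.
by apply: HA; [exact: gam_neq0 | exact: oct_gam].
Qed.
Lemma moving_root x : f.[x] = 0 -> exists2 z, z != 0 &
  act A (gam e U.[x] T.[x]) = (0, 0, z).
Proof.
rewrite -[f.[x]]/(atx x (cub _ _)) -cub_map atxC => f0.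
have := congr1 (atx x) oct_moving; rewrite -oct_map atxC rmorph0 => g0.
have := act_neq0 (gam_neq0 e0 e1 (UT x)); rewrite -at_moving.
case: (map3 _ a) f0 g0 => [[x' y'] z'] f0 g0 n0.
have [x0 y0] := cub_oct_eq0 e'0 f0 g0; exists z'; last by rewrite x0 y0.
by apply/eqP => z0; apply: n0; rewrite x0 y0 z0.
Qed.

Hypothesis f0 : f != 0.

Lemma moving_tt_nn x : f.[x] != 0 -> D.[x] != 0 /\ N.[x] != 0.
Proof.
move=> fx; have := congr1 (atx x) (tt_nn oct_moving f0).
rewrite rmorphM rmorphXn rmorphN rmorphM rmorphXn atxC !atxE => E.
have : - (e' * f.[x] ^+ 5) != 0 by rewrite oppr_eq0 mulf_neq0 ?expf_neq0.
by rewrite -E mulf_eq0 expf_eq0 negb_or => /andP[].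
Qed.
Lemma moving_gam s U' T' : s != 0 -> N = s * U' -> D = s * T' ->
  par a (gam e'%:P U' T').
Proof.
move=> s0 NE DE; have := gam_nn_tt oct_moving.
rewrite -/N -/D NE DE gam_scal scalA; apply: par_scal.
by rewrite mulf_neq0 ?expf_neq0.
Qed.
End Moving.

Lemma act_e3 z : act A (0, 0, z) = scal z (A 0 ord_max, A 1 ord_max, A ord_max ord_max).
Proof. by rewrite /act /scal; congr (_, _, _); ring. Qed.

(** A fixes the node. Otherwise the node is the image of a point v0 off the cubic, which has a
    single parameter; on the other parameters, an affine line, the image never meets the cubic, so
    its parameter on the second octic is given by polynomials without zeros. *)
Lemma axis_preserved : A 0 ord_max = 0 /\ A 1 ord_max = 0.
Proof.
have [E|nE] := eqVneq (A 0 ord_max, A 1 ord_max) (0, 0); first by case: E.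
exfalso; pose v0 := act (invmx A) (0, 0, 1).
have Av0 : act A v0 = (0, 0, 1) by exact: actVK.
have v00 : v0 <> (0, 0, 0).
  by move=> E; move: Av0; rewrite E act0 => -[] /eqP; rewrite eq_sym oner_eq0.
have g0 : oct e v0 = 0 by apply: HA' => //; rewrite Av0 oct00.
have f0 : cub e v0 != 0.
  apply/eqP; move: g0; case E : v0 => [[x y] z] g0 f0.
  have [x0 y0] := cub_oct_eq0 e0 f0 g0; move: Av0; rewrite E x0 y0 act_e3.
  case=> /eqP + /eqP + Z; rewrite !mulf_eq0.
  have z0 : z != 0 by apply/eqP => z0; move/eqP: Z; rewrite z0 mul0r eq_sym oner_eq0.
  rewrite (negPf z0) => /eqP a0 /eqP b0; by move: nE; rewrite a0 b0 eqxx.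
pose t0 := tt_ e v0; pose n0 := nn_ e v0.
have tn0 : t0 ^+ 2 * n0 != 0.
  by rewrite /t0 /n0 tt_nn // oppr_eq0 mulf_neq0 ?expf_neq0.
have t00 : t0 != 0 by move: tn0; rewrite mulf_eq0 expf_eq0 negb_or => /andP[].
pose u0 := n0 / t0.
(* (u0 x + 1 : x) runs through all parameters except (u0 : 1), the one of v0. *)
pose U : {poly k} := u0%:P * 'X + 1; pose T : {poly k} := 'X.
have Ux x : U.[x] = u0 * x + 1 by rewrite /U !hornerE.
have UT x : (U.[x], T.[x]) != (0, 0).
  rewrite Ux hornerX xpair_eqE negb_and.
  by have [->|_] := eqVneq x 0; rewrite ?orbT // mulr0 add0r oner_eq0.
pose a := act (map_mx polyC A) (gam e%:P U T).
have fz x : (cub e'%:P a).[x] != 0.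
  apply/eqP => /(moving_root UT) [z z0 Ez].
  have {}Ez : gam e U.[x] T.[x] = scal z v0.
    rewrite -[LHS]actK Ez /v0 -act_scal; congr act.
    by rewrite /scal !mulr0 mulr1.
  have c0 : cub e (gam e U.[x] T.[x]) != 0 by rewrite Ez cub_scal mulf_neq0 ?expf_neq0.
  have ttE : tt_ e (gam e U.[x] T.[x]) * n0 = nn_ e (gam e U.[x] T.[x]) * t0.
    by rewrite /nn_ Ez tt_scal x3_scal x2_scal cub_scal /n0 /t0 /nn_ /tt_; ring.
  move: c0; rewrite cubphi mulf_eq0 expf_eq0 (negPf e0) => c0.
  move: ttE; rewrite /tt_ /nn_ x2_phi cubphi.
  have -> : x3_ e (gam e U.[x] T.[x]) =
    e ^+ 2 * (U.[x] - e * T.[x]) * cub e (line_pt e U.[x] T.[x]) ^+ 13 by exact: x3_phi.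
  move: (cub e (line_pt e U.[x] T.[x])) c0 => c c0 E.
  have E2 : e ^+ 2 * c ^+ 13 * (1 - e) * (T.[x] * n0 - U.[x] * t0) = 0.
    by move/eqP: E; rewrite -subr_eq0 => /eqP E; rewrite -[RHS]E; ring.
  have h : e ^+ 2 * c ^+ 13 * (1 - e) != 0 by rewrite !mulf_neq0 ?expf_neq0.
  move/eqP: E2; rewrite mulf_eq0 (negPf h) orFb.
  rewrite Ux hornerX mulrDl mul1r mulrAC /u0 divfK // [n0 * x]mulrC opprD addrA subrr sub0r.
  by rewrite oppr_eq0 (negPf t00).
have f0' : cub e'%:P a != 0.
  by apply/eqP => E; move: (fz 0); rewrite E horner0 eqxx.
(* Without zeros [D] and [N] are constant: the image of the curve would be a point. *)
have [|d dE] := @poly_noroot _ (tt_ e'%:P a).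
  by move=> x; have [] := moving_tt_nn UT f0' (fz x).
have [|n nE'] := @poly_noroot _ (nn_ e'%:P a).
  by move=> x; have [] := moving_tt_nn UT f0' (fz x).
have d0 : (n, d) != (0, 0).
  have [+ _] := moving_tt_nn UT f0' (fz 0); rewrite dE hornerC => d0.
  by rewrite xpair_eqE negb_and d0 orbT.
have P := @moving_gam U T UT f0' 1 n%:P d%:P (oner_neq0 _).
rewrite !mul1r in P; have {}P := P nE' dE.
have b0 := gam_neq0 e'0 e1' d0.
have Px x : exists c, act A (gam e U.[x] T.[x]) = scal c (gam e' n d).
  apply: par_colinear => //; have := par_map (atx x) P.
  by rewrite at_moving -gam_map !atxC.
have [c0 Ec0] := Px 0; rewrite Ux hornerX mulr0 add0r gam10 in Ec0.
(* A second parameter, with U and T nonzero, hence off the cubic, whereas x = 0 gives the node: the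
   two image points must differ. *)
have [x1 x1P] : exists x : k, x * (u0 * x + 1) = 1.
  have : size ('X * (u0%:P * 'X + 1) - 1 : {poly k}) != 1%N.
    apply/negP => /size_poly1P [c _ E].
    have := congr1 (fun p : {poly k} => p`_1) E.
    rewrite coefB coefXM coefD coefCM coefX !coefC /= mulr0 add0r subr0 => /eqP.
    by rewrite oner_eq0.
  case/closed_rootP => x /rootP; rewrite !hornerE => /eqP; rewrite subr_eq0 => /eqP xE.
  by exists x.
have x10 : x1 != 0 by apply/eqP => E; move/eqP: x1P; rewrite E mul0r eq_sym oner_eq0.
have U10 : U.[x1] != 0.
  by rewrite Ux; apply/eqP => E; move/eqP: x1P; rewrite E mulr0 eq_sym oner_eq0.
have T10 : T.[x1] != 0 by rewrite hornerX.
have cg := cub_gam_neq0 e0 e1 U10 T10.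
have [c1 Ec1] := Px x1.
have c00 : c0 != 0.
  apply/eqP => E; have : act A (0, 0, - e ^+ 5) <> (0, 0, 0).
    apply: act_neq0 => -[] /eqP; rewrite oppr_eq0 expf_eq0 (negPf e0).
    by [].
  by apply; rewrite Ec0 E; case: (gam e' n d) => [[x y] z]; rewrite /scal !mul0r.
have E : gam e U.[x1] T.[x1] = scal (c1 / c0) (0, 0, - e ^+ 5).
  rewrite -[LHS]actK -[RHS]actK; congr act.
  by rewrite Ec1 act_scal Ec0 scalA divfK.
by move: cg; rewrite E cub_scal /cub => /eqP []; ring.
Qed.

Lemma par23 (R : comNzRingType) (v w : R * R * R) : par v w ->
  comp3 v 1 * w.2 = comp3 v ord_max * w.1.2.
Proof. by case: v w => [[x y] z] [[x' y'] z'] []. Qed.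

Lemma act_row i : comp3 (act (map_mx polyC A) (gam e%:P 'X 1)) i =
  row_comb e (A i 0, A i 1, A i ord_max).
Proof.
rewrite /row_comb; case: (gam _ _ _) => [[x y] z].
by case: (ord3P i) => ->; rewrite /comp3 /= !mxE.
Qed.

Lemma size_z2_comp (p : nat -> k) m : p 8%N != 0 -> (0 < m)%N ->
  size ((\poly_(i < 9) p i) \Po 'X^m) = (8 * m).+1.
Proof.
move=> p8 m0; have := size_comp_poly (\poly_(i < 9) p i) 'X^m.
rewrite size_poly_eq // size_polyXn /=; case: (size _) => [/eqP|s <- //].
by rewrite eq_sym muln_eq0 /= -leqn0 leqNgt m0.
Qed.

Lemma comp_poly9 (p : nat -> k) m :
  (\poly_(i < 9) p i) \Po 'X^m = \sum_(i < 9) (p i)%:P * ('X^m) ^+ i.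
Proof.
rewrite poly_def raddf_sum /=; apply: eq_bigr => i _.
by rewrite comp_polyZ comp_Xn_poly mul_polyC.
Qed.

(** The second coordinate of [gam] is u^2 t^4 times a multiple of e u^2 + e (e - 3) u t + t^2.
    Scaling u and t preserves the square of the middle coefficient over the product of the outer
    ones, which is e (e - 3)^2. *)
Lemma moving_invariant : e * (e - 3) ^+ 2 = e' * (e' - 3) ^+ 2.
Proof.
have [A02 A12] := axis_preserved.
have A22 : A ord_max ord_max != 0.
  apply/eqP => A22; have : act A (0, 0, 1) <> (0, 0, 0).
    by apply: act_neq0 => -[] /eqP; rewrite oner_eq0.
  by rewrite act_e3 A02 A12 A22 /scal !mulr0.
pose U : {poly k} := 'X; pose T : {poly k} := 1.
have Tx x : T.[x] = 1 by exact: hornerC.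
have UT x : (U.[x], T.[x]) != (0, 0) by rewrite Tx xpair_eqE oner_eq0 andbF.
pose a := act (map_mx polyC A) (gam e%:P U T).
have fz x : x != 0 -> (cub e'%:P a).[x] != 0.
  move=> x0; apply/eqP => /(moving_root UT) [z z0 Ez].
  have E : gam e U.[x] T.[x] = (0, 0, z / A ord_max ord_max).
    rewrite -[LHS]actK -[RHS]actK; congr act.
    by rewrite Ez act_e3 A02 A12 /scal !mulr0 divfK.
  have Ux0 : U.[x] != 0 by rewrite hornerX.
  have Tx0 : T.[x] != 0 by rewrite Tx oner_eq0.
  have := cub_gam_neq0 e0 e1 Ux0 Tx0.
  by rewrite E /cub => /eqP []; ring.
have f0 : cub e'%:P a != 0.
  by apply/eqP => E; move: (fz 1 (oner_neq0 _)); rewrite E horner0 eqxx.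
have [d [i [d0 DE]]] := poly_root0_monomial (fun x x0 => (moving_tt_nn UT f0 (fz x x0)).1).
have [n [j [n0 NE]]] := poly_root0_monomial (fun x x0 => (moving_tt_nn UT f0 (fz x x0)).2).
have aE l : comp3 a l = row_comb e (A l 0, A l 1, A l ord_max) by exact: act_row.
have Rneq0 l : row_comb e (A l 0, A l 1, A l ord_max) != 0.
  apply/eqP => /(row_comb_eq0 e1) [l0 l1 l2].
  have [h0 h1 h2] : [/\ (l == 0)%:R = 0 :> k, (l == 1)%:R = 0 :> k & (l == ord_max)%:R = 0 :> k].
    apply: row_free3 => c.
    have -> : (l == 0)%:R * A 0 c + (l == 1)%:R * A 1 c + (l == ord_max)%:R * A ord_max c = A l c.
      by case: (ord3P l) => -> /=; ring.
    by case: (ord3P c) => ->.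
  by case: (ord3P l) h0 h1 h2 => -> /= + + + => /eqP + /eqP + /eqP; rewrite oner_eq0.
(* Gauss's lemma: proportional to a coprime pair means multiple of it by a polynomial h, which the
   degree then shows to be constant. *)
have factor V S : par a (gam e'%:P V S) ->
  (forall x, (V.[x], S.[x]) != (0, 0)) -> (gam e'%:P V S).2 != 0 ->
  exists2 h, row_comb e (A 1 0, A 1 1, 0) = h * (gam e'%:P V S).1.2 &
             row_comb e (A ord_max 0, A ord_max 1, A ord_max ord_max) = h * (gam e'%:P V S).2.
Proof.
  move=> P VS b0; have := aE 1; have := aE ord_max; rewrite A12 => <- <-.
  have cop : coprimep (gam e'%:P V S).2 (gam e'%:P V S).1.2.
    apply: coprimep_noroot => x b2x b1x.
    have E : gam e' V.[x] S.[x] = map3 (atx x) (gam e'%:P V S).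
      by rewrite -gam_map !atxC.
    apply: (line_coprime e'0 e1' h2' (VS x)).
      by rewrite -[LHS]/((gam e' V.[x] S.[x]).1.2) E; exact: b1x.
    by rewrite -[LHS]/((gam e' V.[x] S.[x]).2) E; exact: b2x.
  have := par23 P; move: (comp3 a 1) (comp3 a ord_max) => a1 a2.
  case: (gam e'%:P V S) b0 cop {P} => [[b0 b1] b2]; rewrite [_.2]/= [_.1.2]/= => b20 cop E.
  have : b2 %| a2 by rewrite -(Gauss_dvdpl _ cop) -E dvdp_mulIr.
  case/dvdpP => h hE; exists h => //.
  by apply: (mulIf b20); rewrite E hE; ring.
have size_h (h b2 : {poly k}) m : (0 < m)%N -> size b2 = (8 * m).+1 ->
   row_comb e (A ord_max 0, A ord_max 1, A ord_max ord_max) = h * b2 ->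
   m = 1%N /\ exists2 c, c != 0 & h = c%:P.
  move=> m0 sb hE; have := size_row_comb e (A ord_max 0, A ord_max 1, A ord_max ord_max).
  have := Rneq0 ord_max; rewrite hE mulf_eq0 negb_or => /andP[h0 b0].
  rewrite size_mul // sb addnS /=; have sh : (0 < size h)%N by rewrite size_poly_gt0.
  case: m m0 sb => [//|[|m]] _ _; last first.
    move/(leq_trans (leq_addl (size h) _)).
    by rewrite !mulnS -[9%N]/(8 + 1)%N leq_add2l leqNgt ltn_addr.
  rewrite muln1 => s9; split=> //; apply/size_poly1P.
  by move: s9; rewrite -[9%N]/(1 + 8)%N leq_add2r eqn_leq sh andbT.
have c3 : (1 - e) ^+ 3 != 0 by exact: expf_neq0.
have c6 : (1 - e) ^+ 6 != 0 by exact: expf_neq0.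
have c36 : (1 - e) ^+ 3 * e ^+ 3 != 0 by rewrite mulf_neq0 ?expf_neq0.
have b1E (u t : {poly k}) : (gam e'%:P u t).1.2 =
    - (e'%:P * u ^+ 2 + (e' * (e' - 3))%:P * u * t + t ^+ 2)
    * (((1 - e') ^+ 6)%:P * u ^+ 2 * t ^+ 4).
  rewrite -[LHS]/(x2_ (line_pt e'%:P u t) * cub e'%:P (line_pt e'%:P u t) ^+ 2).
  rewrite x2_line cub_line !(polyCM, polyCB, polyC1, polyC_exp, polyC_natr).
  by move: e'%:P => c; ring.
(* So [A] maps parameter [u] to [(n/d) u^(j-i)]; the degree 8 forces
   [j - i = 1] or [-1]. *)
have [ij|ji] := leqP i j.
  have P : par a (gam e'%:P (n%:P * 'X^(j - i)) d%:P).
    apply: (@moving_gam U T UT f0 'X^i); first by rewrite expf_neq0 ?polyX_eq0.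
      by rewrite NE mulrCA -exprD subnKC.
    by rewrite DE mulrC.
  have bE : (gam e'%:P (n%:P * 'X^(j - i)) d%:P).2 =
     (\poly_(l < 9) (zc e' l * n ^+ l * d ^+ (8 - l))) \Po 'X^(j - i).
    rewrite -[LHS]/(z2_ e'%:P (line_pt _ _ _)) comp_poly9 z2_line; apply: eq_bigr => l _.
    by rewrite zc_map !polyCM !polyC_exp exprMn [_ * (_ * _)]mulrA [LHS]mulrAC.
  have VS x : ((n%:P * 'X^(j - i)).[x], d%:P.[x]) != (0, 0).
    by rewrite hornerC xpair_eqE (negPf d0) andbF.
  (* A constant parameter would make the last two rows of A linearly dependent. *)
  case: (posnP (j - i)) => [ji0|ji0].
    rewrite ji0 expr0 mulr1 in P VS.
    have P1 := par23 P; have {}VS := VS 0; rewrite !hornerC in VS.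
    have gC : gam e'%:P n%:P d%:P = map3 (GRing.RMorphism.clone _ _ polyC _) (gam e' n d).
      exact: gam_map.
    set x := (gam e' n d).2; set y := (gam e' n d).1.2.
    have E : row_comb e (A 1 0, A 1 1, 0) * x%:P
        - row_comb e (A ord_max 0, A ord_max 1, A ord_max ord_max) * y%:P = 0.
      by move: P1; rewrite gC !aE A12 => ->; exact: subrr.
    rewrite row_comb_lin in E; have [E0 E1 E2] := row_comb_eq0 e1 E.
    have [_ x0 y0] : [/\ (0 : k) = 0, x = 0 & - y = 0].
      apply: row_free3 => l.
      case: (ord3P l) => ->; rewrite ?A12 ?A02.
      - by rewrite -[RHS]E0 /=; ring.
      - by rewrite -[RHS]E1 /=; ring.
      by rewrite -[RHS]E2 /=; ring.
    move/eqP: y0; rewrite oppr_eq0 => /eqP y0.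
    by case: (line_coprime e'0 e1' h2' VS y0 x0).
  have p8 : zc e' 8 * n ^+ 8 * d ^+ (8 - 8) != 0.
    by rewrite /zc /= mulr1 mulf_neq0 ?expf_neq0 // oppr_eq0 expf_neq0.
  have sz := size_z2_comp (p := fun l => zc e' l * n ^+ l * d ^+ (8 - l)) p8 ji0.
  rewrite -bE in sz; have b20 : (gam e'%:P (n%:P * 'X^(j - i)) d%:P).2 != 0.
    by rewrite -size_poly_gt0 sz.
  have [h h1 h2] := factor _ _ P VS b20.
  have [m1 [c c0 hE]] := size_h _ _ _ ji0 sz h2.
  rewrite m1 hE b1E in h1.
  pose M := c * (1 - e') ^+ 6 * n ^+ 2 * d ^+ 4.
  have M0 : M != 0 by rewrite /M !mulf_neq0 ?expf_neq0.
  have {}h1 : row_comb e (A 1 0, A 1 1, 0) =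
     - (M * e' * n ^+ 2)%:P * 'X^4 - (M * (e' * (e' - 3)) * n * d)%:P * 'X^3
     - (M * d ^+ 2)%:P * 'X^2.
    rewrite h1 /M !(polyCM, polyC_exp) expr1; move: (_%:P) (_%:P) => ? ?; ring.
  have coef l : (row_comb e (A 1 0, A 1 1, 0))`_l =
     - (M * e' * n ^+ 2) * (l == 4)%:R - (M * (e' * (e' - 3)) * n * d) * (l == 3)%:R
     - (M * d ^+ 2) * (l == 2)%:R.
    by rewrite h1 -polyCN !coefB !coefCM !coefXn.
  have A10 : A 1 0 = 0.
    have := coef 6; rewrite row_comb6 /= !mulr0 !subr0 => /eqP.
    by rewrite mulNr oppr_eq0 mulf_eq0 (negPf c36) orbF => /eqP.
  rewrite A10 in coef.
  have := coef 2; rewrite row_comb2 /= !mulr0 !subr0 sub0r mulr1 => /oppr_inj C2.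
  have := coef 3; rewrite row_comb3 /= C2 !mulr0 subr0 sub0r mulr1 mulNr => /oppr_inj C3.
  have := coef 4; rewrite row_comb4 /= C2 !mulr0 !subr0 mulr1 mulNr => /oppr_inj C4.
  have {}C3 : d * (e * (e - 3)) = e' * (e' - 3) * n.
    apply: (mulfI (mulf_neq0 M0 d0)).
    by transitivity (M * d ^+ 2 * (e * (e - 3))); [ring | rewrite C3; ring].
  have {}C4 : d ^+ 2 * e = e' * n ^+ 2.
    by apply: (mulfI M0); rewrite [LHS]mulrA [RHS]mulrA C4.
  have de0 : d ^+ 2 * e != 0 by rewrite mulf_neq0 ?expf_neq0.
  apply: (mulfI de0).
  have -> : d ^+ 2 * e * (e * (e - 3) ^+ 2) = (d * (e * (e - 3))) ^+ 2 by ring.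
  by rewrite C3 C4; ring.
have P : par a (gam e'%:P n%:P (d%:P * 'X^(i - j))).
  apply: (@moving_gam U T UT f0 'X^j); first by rewrite expf_neq0 ?polyX_eq0.
    by rewrite NE mulrC.
  by rewrite DE mulrCA -exprD subnKC // ltnW.
have ij0 : (0 < i - j)%N by rewrite subn_gt0.
have bE : (gam e'%:P n%:P (d%:P * 'X^(i - j))).2 =
   (\poly_(l < 9) (zc e' (8 - l) * n ^+ (8 - l) * d ^+ l)) \Po 'X^(i - j).
  rewrite -[LHS]/(z2_ e'%:P (line_pt _ _ _)) comp_poly9 z2_line [RHS](reindex_inj rev_ord_inj) /=.
  apply: eq_bigr => l _; have l8 : (l <= 8)%N by rewrite -ltnS ltn_ord.
  have -> : (9 - l.+1 = 8 - l)%N by rewrite subSS.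
  rewrite (subKn l8).
  by rewrite zc_map !polyCM !polyC_exp exprMn [LHS]mulrA.
have VS x : (n%:P.[x], (d%:P * 'X^(i - j)).[x]) != (0, 0).
  by rewrite hornerC xpair_eqE (negPf n0).
have p8 : zc e' (8 - 8) * n ^+ (8 - 8) * d ^+ 8 != 0.
  by rewrite /zc /= mulr1 mulN1r oppr_eq0 expf_neq0.
have sz := size_z2_comp (p := fun l => zc e' (8 - l) * n ^+ (8 - l) * d ^+ l) p8 ij0.
rewrite -bE in sz; have b20 : (gam e'%:P n%:P (d%:P * 'X^(i - j))).2 != 0.
  by rewrite -size_poly_gt0 sz.
have [h h1 h2] := factor _ _ P VS b20.
have [m1 [c c0 hE]] := size_h _ _ _ ij0 sz h2.
(* Here r and s would be exchanged, so the factor t^4 of the second coordinate turns into X^4. The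
   coefficients 1 and 2 then kill the second row of A. *)
have [q qE] : exists q, row_comb e (A 1 0, A 1 1, 0) = q * 'X^4.
  rewrite h1 b1E m1 expr1; set u := - _; set w := (_ ^+ 6)%:P.
  exists (h * u * w * n%:P ^+ 2 * d%:P ^+ 4); ring.
have A10 : A 1 0 = 0.
  have := row_comb1 e (A 1 0) (A 1 1); rewrite qE coefMXn /= => /esym/eqP.
  by rewrite mulf_eq0 (negPf c3) orbF => /eqP.
have A11 : A 1 1 = 0.
  rewrite A10 in qE; have := row_comb2 e (A 1 1); rewrite qE coefMXn /= => /esym/eqP.
  by rewrite oppr_eq0 mulf_eq0 (negPf c6) orbF => /eqP.
have /eqP[] := Rneq0 1; rewrite A10 A11 A12 /row_comb.
by rewrite !mul0r !addr0.
Qed.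
End NonEquivalence.

Lemma octic_not_proj_equiv (k : closedFieldType) (e e' : k) : e * e' = 1 ->
  1 - e != 0 -> 1 + e != 0 -> e ^+ 2 - 4 * e + 1 != 0 -> 2 + e != 0 ->
  ~ proj_equiv (octic e) (octic e').
Proof.
move=> ee' e1 e2 e3 e4 [A [uA H]].
have [e0 e'0] : e != 0 /\ e' != 0.
  by split; apply/eqP => E; move/eqP: ee'; rewrite E ?mulr0 ?mul0r eq_sym oner_eq0.
have e1' : 1 - e' != 0.
  apply: contra e1 => /eqP h; apply/eqP.
  have -> : 1 - e = e * e' - e by rewrite ee'.
  have -> : e * e' - e = - (e * (1 - e')) by ring.
  by rewrite h mulr0 oppr0.
have h2' : 1 + 2 * e' != 0.
  have -> : 1 + 2 * e' = e' * (2 + e) by rewrite -ee'; ring.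
  by rewrite mulf_neq0.
have HH v : v <> (0, 0, 0) -> (oct e v == 0) = (oct e' (act A v) == 0).
  move=> v0; have c0 : col3 v != 0 by rewrite -tr_eq0 tr_col3; apply/eqP.
  have E1 : ev (octic e) (col3 v) = oct e v.
    exact: etrans (ev_octic e _) (congr1 (oct e) (tr_col3 v)).
  have E2 : ev (octic e') (A *m col3 v) = oct e' (act A v).
    apply: etrans (ev_octic e' _) (congr1 (oct e') _).
    by rewrite tr_mulmx tr_col3.
  by rewrite -E1 -E2; exact: H.
have HA v : v <> (0, 0, 0) -> oct e v = 0 -> oct e' (act A v) = 0.
  by move=> v0 /eqP; rewrite HH // => /eqP.
have HA' v : v <> (0, 0, 0) -> oct e' (act A v) = 0 -> oct e v = 0.
  by move=> v0 /eqP; rewrite -HH // => /eqP.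
have E := moving_invariant ee' e1 e1' h2' uA HA HA'.
have : (1 - e) ^+ 3 * (1 + e) * (e ^+ 2 - 4 * e + 1) = 0.
  have -> : (1 - e) ^+ 3 * (1 + e) * (e ^+ 2 - 4 * e + 1)
    = (1 - 3 * e) ^+ 2 - e ^+ 3 * (e * (e - 3) ^+ 2) by ring.
  rewrite E; have -> : e ^+ 3 * (e' * (e' - 3) ^+ 2)
    = e * e' * (e * e' - 3 * e) ^+ 2 by ring.
  by rewrite ee'; ring.
by apply/eqP; rewrite !mulf_neq0 ?expf_neq0.
Qed.

(** The product p of the conditions is nonzero in every characteristic and vanishes at 0, so p - 1
    is not constant; at a root of p - 1 no factor of p vanishes. *)
Lemma exists_parameter (k : closedFieldType) : exists e : k,
  [/\ e != 0, 1 - e != 0, 1 + e != 0, e ^+ 2 - 4 * e + 1 != 0 & 2 + e != 0].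
Proof.
pose p : {poly k} := 'X * (1 - 'X) * (1 + 'X) * ('X^2 - 4%:P * 'X + 1) * (2%:P + 'X).
have pE x : p.[x] = x * (1 - x) * (1 + x) * (x ^+ 2 - 4 * x + 1) * (2 + x).
  by rewrite /p !hornerE.
have p0 : p != 0.
  have nz (q : {poly k}) i : q`_i != 0 -> q != 0.
    by apply: contra => /eqP ->; rewrite coef0.
  rewrite /p !mulf_neq0 //.
  - by rewrite polyX_eq0.
  - by apply: (@nz _ 0); rewrite coefB coefX coef1 subr0 oner_eq0.
  - by apply: (@nz _ 0); rewrite coefD coefX coef1 addr0 oner_eq0.
  - by apply: (@nz _ 0); rewrite !coefD coefN coefCM coefX coefXn coef1 mulr0 subr0 add0r oner_eq0.
  (* The coefficient of X is used because the constant 2 vanishes in characteristic 2. *)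
  by apply: (@nz _ 1); rewrite coefD coefX coefC add0r oner_eq0.
have [x px] : exists x, root (p - 1) x.
  apply/closed_rootP; apply: contra p0 => /size_poly1P [c _ E].
  have c1 : c = - 1.
    have := congr1 (fun q : {poly k} => q.[0]) E.
    by rewrite hornerC hornerD hornerN hornerC pE !mul0r add0r.
  by apply/eqP/(addIr (- 1)); rewrite E c1 add0r polyCN.
have {}px : x * (1 - x) * (1 + x) * (x ^+ 2 - 4 * x + 1) * (2 + x) = 1.
  by rewrite -pE; move/rootP: px; rewrite hornerD hornerN hornerC => /eqP; rewrite subr_eq0 => /eqP.
have : x * (1 - x) * (1 + x) * (x ^+ 2 - 4 * x + 1) * (2 + x) != 0 by rewrite px oner_eq0.
rewrite mulf_eq0 negb_or => /andP[+ h5]; rewrite mulf_eq0 negb_or => /andP[+ h4].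
rewrite mulf_eq0 negb_or => /andP[+ h3]; rewrite mulf_eq0 negb_or => /andP[h1 h2].
by exists x.
Qed.

Theorem theorem1p5 (k : closedFieldType) :
  exists F G : {mpoly k[3]},
    irreducible_plane_curve 8 F /\ irreducible_plane_curve 8 G /\
    mult_seq_3_7 F /\ mult_seq_3_7 G /\
    ~ proj_equiv F G /\ compl_isomorphic F G.
Proof.
have [e [e0 e1 e2 e3 e4]] := exists_parameter k.
have ee' : e * e^-1 = 1 by rewrite mulfV.
have e'0 : e^-1 != 0 by rewrite invr_eq0.
exists (octic e), (octic e^-1).
split; first exact: octic_irreducible_curve.
split; first exact: octic_irreducible_curve.
split; first exact: octic_mult_seq.
split; first exact: octic_mult_seq.
split; first exact: octic_not_proj_equiv.
exact: octic_compl_isomorphic.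
Qed.
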